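(* Let $\alpha=\eta+i\zeta$ with $\eta,\zeta\in\mathbb{R}$, $\eta>0$ and $\zeta\neq 0$. For $n\in\mathbb{N}$ let $$p_n(z)={}_2F_1(-n,\alpha n+1;\alpha n+2;z)=\sum_{k=0}^{n}\frac{(-n)_k(\alpha n+1)_k}{(\alpha n+2)_k}\frac{z^k}{k!}.$$ Then, as $n\to\infty$, the zeros of the polynomials $p_n$ cluster on the level curve $$|z^{\alpha}(1-z)|=\left|\left(\frac{\alpha}{\alpha+1}\right)^{\alpha}(\alpha+1)^{-1}\right|.$$ That is: if $n_j\to\infty$ is a sequence of positive integers, $z_j\in\mathbb{C}$ satisfies $p_{n_j}(z_j)=0$ for every $j$, and $z_j\to z\in\mathbb{C}$, then $z$ satisfies the displayed equation.
   Context: $(a)_k=a(a+1)\cdots(a+k-1)$, $(a)_0=1$, is the Pochhammer symbol. Complex powers are defined by the principal branch of the logarithm: $w^{\alpha}=e^{\alpha\log w}$ for $w\neq 0$, and $0^\alpha=0$. *)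

(* Defs.v *)
From Stdlib Require Import Reals Factorial Lra.
(* Coquelicot comes last: its complex type C must shadow the binomial C of Reals. *)
From Coquelicot Require Import Coquelicot.

Local Open Scope C_scope.

(* Principal argument, in (-PI, PI]; the value at 0 is irrelevant (it never
   enters [Cpower]). *)
Definition Carg (w : C) : R :=
  if Rle_dec 0 (Im w) then acos (Re w / Cmod w)%R
  else (- acos (Re w / Cmod w))%R.

Definition Clog (w : C) : C := (ln (Cmod w), Carg w).

Definition Cexp (w : C) : C :=
  ((exp (Re w) * cos (Im w))%R, (exp (Re w) * sin (Im w))%R).

Definition Cpower (w a : C) : C :=
  if Ceq_dec w 0 then RtoC 0 else Cexp (a * Clog w).

Fixpoint Pochhammer (a : C) (k : nat) : C :=
  match k with
  | O => RtoC 1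
  | S k' => Pochhammer a k' * (a + INR k')
  end.

(* The terminating series 2F1(-n, b; c; z), truncated at k = n since (-n)_k
   vanishes for k > n. It is meaningful when (c)_k <> 0 for k <= n. *)
Definition hyp2F1_neg (n : nat) (b c z : C) : C :=
  sum_n (fun k => Pochhammer (- INR n) k * Pochhammer b k / Pochhammer c k
                  * (z ^ k / INR (fact k))) n.

Definition p (alpha : C) (n : nat) (z : C) : C :=
  hyp2F1_neg n (alpha * INR n + 1) (alpha * INR n + 2) z.

Lemma Carg_spec (w : C) : w <> 0 ->
  (- PI < Carg w <= PI)%R /\
  w = ((Cmod w * cos (Carg w))%R, (Cmod w * sin (Carg w))%R).
Proof.
intros Hw.
assert (Hm : (0 < Cmod w)%R) by now apply Cmod_gt_0.
assert (Hsq : (Re w * Re w + Im w * Im w = Cmod w * Cmod w)%R).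
{ unfold Cmod. rewrite sqrt_sqrt; [unfold Re, Im; ring|].
  apply Rplus_le_le_0_compat; apply pow2_ge_0. }
set (x := (Re w / Cmod w)%R).
assert (Hx : (Re w = x * Cmod w)%R) by (unfold x; field; lra).
assert (Hx2 : (x * x <= 1)%R).
{ apply Rmult_le_reg_r with (Cmod w * Cmod w)%R; [nra|].
  rewrite Hx in Hsq. nra. }
assert (Hb : (-1 <= x <= 1)%R) by (split; nra).
assert (Hy : (Cmod w * sqrt (1 - x²) = Rabs (Im w))%R).
{ rewrite <- (Rabs_pos_eq (Cmod w)) at 1 by lra.
  rewrite <- (sqrt_Rsqr_abs (Cmod w)), <- sqrt_mult, <- sqrt_Rsqr_abs;
    unfold Rsqr; try nra.
  f_equal. rewrite Hx in Hsq. nra. }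
pose proof (acos_bound x) as Ha.
pose proof PI_RGT_0 as HPI.
unfold Carg; fold x. destruct (Rle_dec 0 (Im w)) as [Hi|Hi].
- split; [lra|].
  rewrite cos_acos, sin_acos, Hy, Rabs_pos_eq by lra.
  rewrite Rmult_comm, <- Hx. now destruct w.
- split.
  + split; [|lra].
    destruct (Req_dec x (-1)) as [E|E].
    * exfalso. rewrite Hx, E in Hsq. nra.
    * destruct (Req_dec x 1) as [F|F].
      -- rewrite F, acos_1. lra.
      -- assert (H := acos_bound_lt x). lra.
  + rewrite cos_neg, sin_neg, cos_acos, sin_acos by lra.
    rewrite Ropp_mult_distr_r_reverse, Hy, Rabs_left by lra.
    rewrite Rmult_comm, <- Hx, Ropp_involutive. now destruct w.
Qed.

Lemma Cexp_Clog (w : C) : w <> 0 -> Cexp (Clog w) = w.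
Proof.
intros Hw. destruct (Carg_spec w Hw) as [_ E].
unfold Cexp, Clog; simpl.
rewrite exp_ln by now apply Cmod_gt_0.
now symmetry.
Qed.

(* Main.v *)
(* In the coordinate z = e^w, put b = alpha n + 1 and F_n(w) = e^(b w) p_n(e^w) / b, the incomplete
   Beta integral of u^(b-1) (1-u)^n from 0 to z. Then F_n' = e^w q^n with
   q(w) = e^(alpha w) (1 - e^w), so that |q| = |z^alpha (1-z)|, and F_n(0) is the Beta integral
   B(b, n+1), of exponential order c^n, where c is the value of |q| at the saddle
   e^w = alpha/(alpha+1). By the mean value inequality an estimate F_n = O(L^n), or
   F_n - B(b, n+1) = O(L^n), propagates along segments inside {|q| <= L}. The first holds near
   z = 0, for Re z <= 0 and near the saddle, the second near z = 1; descending |q| from any other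
   point leads, by compactness, to one of these regions, provided L <> c. If |q(w)| <> c there are
   two cases. Either F_n is exponentially smaller than |q(w)|^n at nearby points where |q| is
   smaller: then F_n is asymptotic to its endpoint contribution and does not vanish near w. Or
   |q(w)| < c and F_n = B(b, n+1) + O(L^n) with L < c near w: then again F_n does not vanish. *)
Require Import Defs.
From Stdlib Require Import Reals Lra Lia Factorial Classical ClassicalEpsilon.
From Coquelicot Require Import Coquelicot.

Local Open Scope R_scope.
Local Open Scope C_scope.

(** * Complex derivatives along real lines, and the complex exponential *)

Bind Scope C_scope with C.
Arguments Cmod _%_C.
Arguments Re _%_C.
Arguments Im _%_C.
Arguments Cexp _%_C.

(** No contour integral is used, only the supremum of |F_n'| along segments. Each segment adds a
    constant multiple of L^n, which exponential rates tolerate. The same crudeness dictates the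
    length of the endpoint expansion: its error is estimated by the supremum of its derivative,
    without the factor 1/n that integrating q^n would gain. With one term that derivative is O(1/n)
    times e^w q^n, and the error bound has the order 1/n of the main term itself. With two terms it
    is O(1/n^2), and the main term wins.

    The logarithmic coordinate makes q entire but separates the sheets: F_n(w + 2 pi i) is F_n(w)
    times a factor of modulus e^(-2 pi zeta n). The alternative between the two estimates is
    therefore stated in the strip |Im w| <= PI, and descent must not leave it. Near the edges, where
    it could, cos (Im w) < 0 and the horizontal ray coming from z = 0 gives the first estimate
    directly.

    At the saddle the gradient of |q|^2 vanishes and descent is impossible; this is where L <> c is
    needed. *)

Definition is_Cderive (f : R -> C) (t : R) (l : C) : Prop :=
  is_derive (fun s => fst (f s)) t (fst l) /\
  is_derive (fun s => snd (f s)) t (snd l).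

(* Holomorphy, tested along real affine lines only. *)
Definition Cdiff (F : C -> C) (w l : C) : Prop :=
  forall (w0 v : C) (t : R), w = w0 + t * v ->
    is_Cderive (fun s => F (w0 + s * v)) t (l * v).

Lemma is_derive_eq (f : R -> R) (x l l' : R) :
  is_derive f x l -> l = l' -> is_derive f x l'.
Proof. now intros H <-. Qed.

Lemma Rderive_plus (f g : R -> R) (x a b : R) :
  is_derive f x a -> is_derive g x b -> is_derive (fun s => f s + g s)%R x (a + b)%R.
Proof. intros Hf Hg. exact (is_derive_plus f g x a b Hf Hg). Qed.

Lemma Rderive_minus (f g : R -> R) (x a b : R) :
  is_derive f x a -> is_derive g x b -> is_derive (fun s => f s - g s)%R x (a - b)%R.
Proof. intros Hf Hg. exact (is_derive_minus f g x a b Hf Hg). Qed.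

Lemma Rderive_mult (f g : R -> R) (x a b : R) :
  is_derive f x a -> is_derive g x b ->
  is_derive (fun s => f s * g s)%R x (a * g x + f x * b)%R.
Proof. intros Hf Hg. apply (is_derive_mult f g x a b Hf Hg). intros; apply Rmult_comm. Qed.

Lemma Cdiff_eq (F : C -> C) (w l l' : C) : Cdiff F w l -> l = l' -> Cdiff F w l'.
Proof. now intros H <-. Qed.

Lemma Cdiff_ext (F G : C -> C) (w l : C) :
  (forall u, F u = G u) -> Cdiff F w l -> Cdiff G w l.
Proof.
intros E H w0 v t Hw. destruct (H w0 v t Hw) as [H1 H2].
split; [eapply is_derive_ext; [|exact H1] | eapply is_derive_ext; [|exact H2]];
  intros; simpl; now rewrite E.
Qed.

Lemma Cdiff_const (c w : C) : Cdiff (fun _ => c) w 0.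
Proof.
intros w0 v t _; split; simpl; eapply is_derive_eq; try apply is_derive_const;
  unfold zero; simpl; ring.
Qed.

Lemma Cdiff_id (w : C) : Cdiff (fun u => u) w 1.
Proof.
intros w0 v t _; split; simpl; auto_derive; trivial; ring.
Qed.

Lemma Cdiff_plus (F G : C -> C) (w a b : C) :
  Cdiff F w a -> Cdiff G w b -> Cdiff (fun u => F u + G u) w (a + b).
Proof.
intros HF HG w0 v t Hw. destruct (HF w0 v t Hw) as [F1 F2], (HG w0 v t Hw) as [G1 G2].
split; simpl; (eapply is_derive_eq; [apply Rderive_plus; eassumption | simpl; ring]).
Qed.

Lemma Cdiff_mult (F G : C -> C) (w a b : C) :
  Cdiff F w a -> Cdiff G w b -> Cdiff (fun u => F u * G u) w (a * G w + F w * b).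
Proof.
intros HF HG w0 v t Hw. destruct (HF w0 v t Hw) as [F1 F2], (HG w0 v t Hw) as [G1 G2].
rewrite Hw; split.
- eapply is_derive_eq;
    [exact (Rderive_minus _ _ _ _ _ (Rderive_mult _ _ _ _ _ F1 G1) (Rderive_mult _ _ _ _ _ F2 G2))|].
  simpl; ring.
- eapply is_derive_eq;
    [exact (Rderive_plus _ _ _ _ _ (Rderive_mult _ _ _ _ _ F1 G2) (Rderive_mult _ _ _ _ _ F2 G1))|].
  simpl; ring.
Qed.

Lemma Cdiff_scal (c : C) (F : C -> C) (w a : C) :
  Cdiff F w a -> Cdiff (fun u => c * F u) w (c * a).
Proof.
intros H. eapply Cdiff_eq; [apply Cdiff_mult; [apply Cdiff_const | exact H]|]. cbv beta; ring.
Qed.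

Lemma Cdiff_opp (F : C -> C) (w a : C) : Cdiff F w a -> Cdiff (fun u => - F u) w (- a).
Proof.
intros H. apply Cdiff_ext with (fun u => (-(1)) * F u); [intros; ring|].
eapply Cdiff_eq; [apply Cdiff_scal, H | ring].
Qed.

Lemma Cdiff_minus (F G : C -> C) (w a b : C) :
  Cdiff F w a -> Cdiff G w b -> Cdiff (fun u => F u - G u) w (a - b).
Proof. intros HF HG. apply Cdiff_plus; [|apply Cdiff_opp]; assumption. Qed.

Lemma Cdiff_pow (F : C -> C) (w a : C) (n : nat) :
  Cdiff F w a -> Cdiff (fun u => F u ^ S n) w (INR (S n) * F w ^ n * a).
Proof.
intros H. induction n as [|n IH].
- apply Cdiff_ext with F; [intros; simpl; ring|].
  eapply Cdiff_eq; [exact H|]. simpl. ring.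
- apply Cdiff_ext with (fun u => F u * F u ^ S n); [intros; simpl; ring|].
  eapply Cdiff_eq; [apply Cdiff_mult; [exact H | exact IH]|]. cbv beta.
  rewrite (S_INR (S n)), RtoC_plus, !Cpow_S. ring.
Qed.

Lemma is_Cderive_inv (f : R -> C) (t : R) (l : C) :
  f t <> 0 -> is_Cderive f t l -> is_Cderive (fun s => / f s) t (- l / (f t * f t)).
Proof.
intros Hnz [F1 F2].
set (m := fun s => (fst (f s) * fst (f s) + snd (f s) * snd (f s))%R).
assert (Hd : m t <> 0%R).
{ intros E. apply Hnz. unfold m in E. apply injective_projections; simpl; nra. }
assert (Dm := Rderive_plus _ _ _ _ _ (Rderive_mult _ _ _ _ _ F1 F1) (Rderive_mult _ _ _ _ _ F2 F2)).
replace (- l / (f t * f t)) with (- l * (/ f t) * (/ f t)) by (field; exact Hnz).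
assert (N : ((fst (f t) ^ 2 + snd (f t) ^ 2)%R <> 0%R)) by (unfold m in Hd; simpl; lra).
split.
- apply is_derive_ext with (fun s => fst (f s) / m s)%R.
  { intros s; unfold m; simpl; f_equal; f_equal; ring. }
  eapply is_derive_eq; [exact (is_derive_div _ _ _ _ _ F1 Dm Hd)|].
  unfold m; simpl. field. simpl in N; lra.
- apply is_derive_ext with (fun s => (- snd (f s)) / m s)%R.
  { intros s; unfold m; simpl; f_equal; f_equal; ring. }
  eapply is_derive_eq; [exact (is_derive_div _ _ _ _ _ (is_derive_opp _ _ _ F2) Dm Hd)|].
  unfold m, opp; simpl. field. simpl in N; lra.
Qed.

Lemma Cdiff_inv (F : C -> C) (w a : C) :
  F w <> 0 -> Cdiff F w a -> Cdiff (fun u => / F u) w (- a / (F w * F w)).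
Proof.
intros Hnz HF w0 v t Hw.
replace (- a / (F w * F w) * v) with (- (a * v) / (F w * F w)) by (field; exact Hnz).
rewrite Hw in Hnz |- *.
apply (is_Cderive_inv (fun s : R => F (w0 + s * v))); [exact Hnz | now apply HF].
Qed.

Lemma Cdiff_exp (F : C -> C) (w a : C) :
  Cdiff F w a -> Cdiff (fun u => Cexp (F u)) w (a * Cexp (F w)).
Proof.
intros HF w0 v t Hw. destruct (HF w0 v t Hw) as [F1 F2].
rewrite Hw. split; simpl.
- eapply is_derive_eq.
  + apply (Rderive_mult (fun s => exp (Re (F (w0 + s * v)))) (fun s => cos (Im (F (w0 + s * v))))).
    * apply (is_derive_comp exp (fun s => Re (F (w0 + s * v)))); [apply is_derive_exp | exact F1].
    * apply (is_derive_comp cos (fun s => Im (F (w0 + s * v)))); [apply is_derive_cos | exact F2].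
  + unfold scal; simpl; unfold mult; simpl. unfold Re, Im. ring.
- eapply is_derive_eq.
  + apply (Rderive_mult (fun s => exp (Re (F (w0 + s * v)))) (fun s => sin (Im (F (w0 + s * v))))).
    * apply (is_derive_comp exp (fun s => Re (F (w0 + s * v)))); [apply is_derive_exp | exact F1].
    * apply (is_derive_comp sin (fun s => Im (F (w0 + s * v)))); [apply is_derive_sin | exact F2].
  + unfold scal; simpl; unfold mult; simpl. unfold Re, Im. ring.
Qed.

Lemma Re_mult_conj_le (a b : C) : (Re (Cconj a * b) <= Cmod a * Cmod b)%R.
Proof.
rewrite <- (Cmod_conj a), <- Cmod_mult.
eapply Rle_trans; [apply Rle_abs | apply re_le_Cmod].
Qed.

(** There is no mean value equality for complex values, so F is projected on the direction d of its
    own increment: the real function g increases by exactly |d|^2, its derivative is at most |d| M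
    |v| by Cauchy-Schwarz, and one factor |d| cancels. *)
Lemma mean_value_ineq (F l : C -> C) (w0 w1 : C) (M : R) :
  (forall t, (0 <= t <= 1)%R ->
     Cdiff F (w0 + t * (w1 - w0)) (l (w0 + t * (w1 - w0))) /\
     Cmod (l (w0 + t * (w1 - w0))) <= M) ->
  Cmod (F w1 - F w0) <= M * Cmod (w1 - w0).
Proof.
intros H.
set (v := w1 - w0) in *. set (d := F w1 - F w0).
set (g := fun t : R => (fst d * fst (F (w0 + t * v)%C) + snd d * snd (F (w0 + t * v)%C))%R).
set (dg := fun t : R => (fst d * fst (l (w0 + t * v) * v)%C + snd d * snd (l (w0 + t * v) * v)%C)%R).
assert (Hd : forall t, (0 <= t <= 1)%R -> is_derive g t (dg t)).
{ intros t Ht. destruct (H t Ht) as [Hl _].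
  destruct (Hl w0 v t eq_refl) as [H1 H2].
  apply Rderive_plus; apply is_derive_scal; assumption. }
destruct (MVT_gen g 0 1 dg) as [c [Hc E]].
- intros x; rewrite Rmin_left, Rmax_right by lra. intros; apply Hd; lra.
- intros x; rewrite Rmin_left, Rmax_right by lra. intros Hx.
  apply continuity_pt_filterlim, (ex_derive_continuous g). eexists. apply Hd, Hx.
- rewrite Rmin_left, Rmax_right in Hc by lra.
  assert (E0 : (g 1 - g 0 = Cmod d ^ 2)%R).
  { rewrite Cmod2_alt. unfold g.
    replace (w0 + 1%R * v) with w1 by (unfold v; ring).
    replace (w0 + 0%R * v) with w0 by (unfold v; ring).
    unfold d, Re, Im; simpl; ring. }
  assert (E1 : (dg c <= Cmod d * (M * Cmod v))%R).
  { eapply Rle_trans with (Cmod d * Cmod (l (w0 + c * v)%C * v))%R.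
    - eapply Rle_trans; [|apply Re_mult_conj_le].
      unfold dg, Re, Cconj; simpl; lra.
    - apply Rmult_le_compat_l; [apply Cmod_ge_0|]. rewrite Cmod_mult.
      apply Rmult_le_compat_r; [apply Cmod_ge_0|]. apply H, Hc. }
  destruct (Req_dec (Cmod d) 0) as [Z|Z].
  + rewrite Z. apply Rmult_le_pos; [|apply Cmod_ge_0].
    eapply Rle_trans; [apply Cmod_ge_0 | apply (proj2 (H 0%R ltac:(lra)))].
  + pose proof (Cmod_ge_0 d). nra.
Qed.

(** * The complex exponential and its injectivity on strips *)

Lemma Cexp_plus (a b : C) : Cexp (a + b) = Cexp a * Cexp b.
Proof.
unfold Cexp, Cmult; simpl. unfold Re, Im; simpl.
rewrite exp_plus, cos_plus, sin_plus. f_equal; ring.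
Qed.

Lemma Cexp_0 : Cexp 0 = 1.
Proof. unfold Cexp; simpl. rewrite exp_0, cos_0, sin_0. unfold RtoC; f_equal; ring. Qed.

Lemma Cmod_Cexp (a : C) : Cmod (Cexp a) = exp (Re a).
Proof.
unfold Cmod, Cexp; simpl.
replace (_ + _)%R with (exp (Re a) ^ 2 * (Rsqr (sin (Im a)) + Rsqr (cos (Im a))))%R
  by (unfold Rsqr; ring).
rewrite sin2_cos2, Rmult_1_r. apply sqrt_pow2, Rlt_le, exp_pos.
Qed.

Lemma Cexp_neq_0 (a : C) : Cexp a <> 0.
Proof. apply Cmod_gt_0. rewrite Cmod_Cexp. apply exp_pos. Qed.

Lemma Cexp_opp (a : C) : Cexp (- a) = / Cexp a.
Proof.
assert (E : Cexp a * Cexp (- a) = 1) by (rewrite <- Cexp_plus, <- Cexp_0; f_equal; ring).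
pose proof (Cexp_neq_0 a) as N.
replace (Cexp (- a)) with (Cexp a * Cexp (- a) / Cexp a) by (field; exact N).
rewrite E. field; exact N.
Qed.

Lemma Cexp_pow (a : C) (n : nat) : Cexp a ^ n = Cexp (INR n * a).
Proof.
induction n as [|n IH].
- simpl. rewrite <- Cexp_0. f_equal. ring.
- rewrite Cpow_S, IH, <- Cexp_plus, S_INR, RtoC_plus. f_equal. ring.
Qed.

Lemma Cexp_eq_1 (w : C) : Cexp w = 1 -> (Rabs (Im w) < 2 * PI)%R -> w = 0.
Proof.
intros E Hi.
assert (Hr : Re w = 0%R).
{ apply exp_inv. rewrite <- Cmod_Cexp, E, exp_0. apply Cmod_1. }
pose proof (f_equal fst E) as E1. pose proof (f_equal snd E) as E2.
simpl in E1, E2. rewrite Hr, exp_0, Rmult_1_l in E1, E2.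
apply Rabs_def2 in Hi. pose proof PI_RGT_0.
assert (Z : Im w = 0%R).
{ assert (Hs : forall x, (0 <= x < 2 * PI)%R -> cos x = 1%R -> x = 0%R).
  { intros x Hx Hc. destruct (Req_dec x 0) as [|Hx0]; [assumption|exfalso].
    assert (Hs : (0 < sin (x / 2))%R) by (apply sin_gt_0; lra).
    replace x with (2 * (x / 2))%R in Hc by field.
    rewrite cos_2a_sin in Hc. nra. }
  destruct (Rle_dec 0 (Im w)).
  - apply Hs; [lra|exact E1].
  - assert (- Im w = 0)%R; [|lra]. apply Hs; [lra|]. now rewrite cos_neg. }
apply injective_projections; assumption.
Qed.

Lemma Cexp_inj (a b : C) :
  Cexp a = Cexp b -> (Rabs (Im a - Im b) < 2 * PI)%R -> a = b.
Proof.
intros E H. assert (Z : a - b = 0).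
{ apply Cexp_eq_1; [|exact H].
  unfold Cminus. rewrite Cexp_plus, Cexp_opp, E. field. apply Cexp_neq_0. }
replace a with (b + (a - b)) by ring. rewrite Z. ring.
Qed.

Lemma Cmult_cancel_l (c a b : C) : c <> 0 -> c * a = c * b -> a = b.
Proof.
intros Hc E. replace a with (/ c * (c * a)) by (field; exact Hc). rewrite E. field; exact Hc.
Qed.

Lemma Cinv_nz (c : C) : c <> 0 -> / c <> 0.
Proof.
intros Hc E. pose proof (Cinv_r c Hc) as H. rewrite E, Cmult_0_r in H.
apply RtoC_inj in H. lra.
Qed.

Lemma exp_mono (x y : R) : (x <= y)%R -> (exp x <= exp y)%R.
Proof.
intros [H | ->]; [left; now apply exp_increasing | apply Rle_refl].
Qed.

(** * The polynomials as Beta integrals *)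

Lemma Csum_n_S (f : nat -> C) (n : nat) : (sum_n f (S n) : C) = sum_n f n + f (S n).
Proof. exact (sum_Sn f n). Qed.

Lemma Csum_n_0 (f : nat -> C) : sum_n f 0 = f 0%nat.
Proof. exact (sum_O f). Qed.

(** Common summation pattern of the binomial theorem (Pascal's rule) and of the recursion for the
    hypergeometric sum (absorption). *)
Lemma sum_n_shift_comb (h f g : nat -> C) (c : C) (n : nat) :
  h 0%nat = f 0%nat -> (forall k, h (S k) = f (S k) + c * g k) ->
  (sum_n h (S n) : C) = sum_n f (S n) + c * sum_n g n.
Proof.
intros H0 HS. induction n as [|n IH].
- rewrite !Csum_n_S, !Csum_n_0, H0, HS. ring.
- rewrite Csum_n_S, IH, (Csum_n_S f (S n)), (Csum_n_S g n), HS. ring.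
Qed.

Lemma Pochhammer_S_l (a : C) (k : nat) : Pochhammer a (S k) = a * Pochhammer (a + 1) k.
Proof.
induction k as [|k IH].
- simpl. ring.
- change (Pochhammer a (S k) * (a + INR (S k)) = a * (Pochhammer (a + 1) k * (a + 1 + INR k))).
  rewrite IH, S_INR, RtoC_plus. ring.
Qed.

Lemma Pochhammer_neg_vanish (n : nat) : Pochhammer (- INR n) (S n) = 0.
Proof. simpl. ring. Qed.

Lemma plus_INR_neq_0 (b : C) (k : nat) : (0 < Re b)%R -> b + INR k <> 0.
Proof.
intros Hb E. apply (f_equal Re) in E. simpl in E. unfold Re in Hb.
pose proof (pos_INR k). lra.
Qed.

Lemma RtoC_INR_S_neq_0 (k : nat) : RtoC (INR (S k)) <> 0.
Proof. intros E. apply RtoC_inj in E. now apply not_0_INR in E. Qed.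

Lemma RtoC_fact_neq_0 (k : nat) : RtoC (INR (fact k)) <> 0.
Proof. intros E. apply RtoC_inj in E. now apply INR_fact_neq_0 in E. Qed.

Lemma Pochhammer_neq_0 (b : C) (k : nat) : (0 < Re b)%R -> Pochhammer b k <> 0.
Proof.
intros Hb. induction k as [|k IH].
- simpl. intros E. apply RtoC_inj in E. lra.
- simpl. apply Cmult_neq_0; [exact IH | now apply plus_INR_neq_0].
Qed.

(** Both sides of (b)_k (b + k) = b (b + 1)_k are (b)_(k+1). Lower parameter b + 1 thus turns the
    series into a binomial sum with weights b/(b + k). *)
Lemma Pochhammer_ratio (b : C) (k : nat) : (0 < Re b)%R ->
  Pochhammer b k / Pochhammer (b + 1) k = b / (b + INR k).
Proof.
intros Hb.
assert (N1 : Pochhammer (b + 1) k <> 0) by (apply Pochhammer_neq_0; simpl; unfold Re in Hb; lra).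
pose proof (plus_INR_neq_0 b k Hb) as N2.
assert (E : Pochhammer b k * (b + INR k) = b * Pochhammer (b + 1) k).
{ rewrite <- Pochhammer_S_l. reflexivity. }
apply Cmult_cancel_l with (b + INR k); [exact N2|].
transitivity (Pochhammer b k * (b + INR k) / Pochhammer (b + 1) k); [field; exact N1|].
rewrite E. field. now split.
Qed.

(** The signed binomial coefficient (-1)^k binom(n, k); it vanishes by itself at k = n + 1. *)
Definition nbinom (n k : nat) : C := Pochhammer (- INR n) k / INR (fact k).

Lemma nbinom_vanish (n : nat) : nbinom n (S n) = 0.
Proof. unfold nbinom. rewrite Pochhammer_neg_vanish. field. apply RtoC_fact_neq_0. Qed.

Lemma nbinom_absorb (n k : nat) :
  INR (S k) * nbinom (S n) (S k) = - INR (S n) * nbinom n k.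
Proof.
unfold nbinom. rewrite Pochhammer_S_l.
replace (- INR (S n) + 1) with (- INR n) by (rewrite S_INR, RtoC_plus; ring).
rewrite fact_simpl, mult_INR, RtoC_mult. field.
split; [apply RtoC_fact_neq_0 | apply RtoC_INR_S_neq_0].
Qed.

Lemma nbinom_pascal (n k : nat) : nbinom (S n) (S k) = nbinom n (S k) - nbinom n k.
Proof.
apply Cmult_cancel_l with (RtoC (INR (S k))); [apply RtoC_INR_S_neq_0|].
rewrite nbinom_absorb. unfold nbinom.
change (Pochhammer (- INR n) (S k)) with (Pochhammer (- INR n) k * (- INR n + INR k)).
replace (RtoC (INR k)) with (INR (S k) - 1) by (rewrite S_INR, RtoC_plus; ring).
rewrite fact_simpl, mult_INR, RtoC_mult, (S_INR n), RtoC_plus.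
field. split; [apply RtoC_fact_neq_0 | apply RtoC_INR_S_neq_0].
Qed.

Lemma sum_nbinom (n : nat) (z : C) : (sum_n (fun k => nbinom n k * z ^ k) n : C) = (1 - z) ^ n.
Proof.
induction n as [|n IH].
- rewrite Csum_n_0. unfold nbinom. simpl. field.
- rewrite (sum_n_shift_comb _ (fun k => nbinom n k * z ^ k) (fun k => nbinom n k * z ^ k) (- z)).
  + rewrite Csum_n_S, IH, nbinom_vanish. simpl. ring.
  + unfold nbinom; simpl; ring.
  + intros k. rewrite nbinom_pascal, Cpow_S. ring.
Qed.

(* [jacQ n b z] is b times the integral of t^(b-1) (1 - z t)^n over [0, 1]; the recursion is
   integration by parts. *)
Fixpoint jacQ (n : nat) (b z : C) : C :=
  match n with
  | O => 1
  | S m => (1 - z) ^ n + INR n * z / (b + 1) * jacQ m (b + 1) z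
  end.

(** Write b/(b + k) = 1 - k/(b + k). The 1 sums to (1 - z)^n; in the rest, absorbing k into the
    binomial coefficient lowers n and raises b, which is the recursion of [jacQ]. *)
Lemma hyp2F1_neg_jacQ (n : nat) (b z : C) : (0 < Re b)%R ->
  hyp2F1_neg n b (b + 1) z = jacQ n b z.
Proof.
intros Hb.
transitivity (sum_n (fun k => nbinom n k * (b / (b + INR k)) * z ^ k) n : C).
{ apply sum_n_ext. intros k. rewrite <- Pochhammer_ratio by exact Hb. unfold nbinom.
  match goal with |- ?x = ?y => change (@eq C x y) end.
  field. split; [apply Pochhammer_neq_0; simpl; unfold Re in Hb; lra | apply RtoC_fact_neq_0]. }
revert b Hb. induction n as [|n IH]; intros b Hb.
- rewrite Csum_n_0. unfold nbinom; simpl. field.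
  intros E. rewrite E in Hb. simpl in Hb. lra.
- assert (Hb1 : (0 < Re (b + 1))%R) by (simpl; unfold Re in Hb; lra).
  rewrite (sum_n_shift_comb _ (fun k => nbinom (S n) k * z ^ k)
     (fun k => nbinom n k * ((b + 1) / (b + 1 + INR k)) * z ^ k) (INR (S n) * z / (b + 1))).
  + rewrite sum_nbinom, IH by exact Hb1. reflexivity.
  + unfold nbinom; simpl. field. intros E. rewrite E in Hb. simpl in Hb. lra.
  + intros k.
    assert (N : b + INR (S k) <> 0) by now apply plus_INR_neq_0.
    assert (N1 : b + 1 <> 0) by exact (plus_INR_neq_0 b 1 Hb).
    assert (N2 : b + 1 + INR k <> 0) by now apply plus_INR_neq_0.
    replace (b / (b + INR (S k))) with (1 - INR (S k) / (b + INR (S k))) by (field; exact N).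
    replace (nbinom (S n) (S k) * (1 - INR (S k) / (b + INR (S k))) * z ^ S k)
      with (nbinom (S n) (S k) * z ^ S k
            - (INR (S k) * nbinom (S n) (S k)) / (b + INR (S k)) * z ^ S k) by (field; exact N).
    rewrite nbinom_absorb.
    replace (b + INR (S k)) with (b + 1 + INR k) by (rewrite (S_INR k), RtoC_plus; ring).
    rewrite Cpow_S. field. now split.
Qed.

(** In the recursion, the term from differentiating (1 - e^u)^(n+1) cancels the derivative of the
    second summand. *)
Lemma Cdiff_jacQ (n : nat) (b w : C) : (0 < Re b)%R ->
  Cdiff (fun u => Cexp (b * u) * jacQ n b (Cexp u)) w (b * (Cexp (b * w) * (1 - Cexp w) ^ n)).
Proof.
revert b. induction n as [|n IH]; intros b Hb.
- eapply Cdiff_ext; [|eapply Cdiff_eq; [apply (Cdiff_exp (fun u => b * u)), Cdiff_scal, Cdiff_id|]].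
  + intros u; simpl; ring.
  + simpl; ring.
- assert (N1 : b + 1 <> 0) by exact (plus_INR_neq_0 b 1 Hb).
  apply Cdiff_ext with (fun u => Cexp (b * u) * (1 - Cexp u) ^ S n
     + INR (S n) / (b + 1) * (Cexp ((b + 1) * u) * jacQ n (b + 1) (Cexp u))).
  { intros u. change (jacQ (S n) b (Cexp u)) with ((1 - Cexp u) ^ S n
      + INR (S n) * Cexp u / (b + 1) * jacQ n (b + 1) (Cexp u)).
    replace ((b + 1) * u) with (b * u + u) by ring. rewrite Cexp_plus. field. exact N1. }
  eapply Cdiff_eq.
  + apply Cdiff_plus.
    * apply Cdiff_mult; [apply (Cdiff_exp (fun u => b * u)), Cdiff_scal, Cdiff_id|].
      apply Cdiff_pow, Cdiff_minus; [apply Cdiff_const | apply (Cdiff_exp (fun u => u)), Cdiff_id].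
    * apply Cdiff_scal, IH. simpl; unfold Re in Hb; lra.
  + cbv beta. replace ((b + 1) * w) with (b * w + w) by ring.
    rewrite Cexp_plus, !Cpow_S. field. exact N1.
Qed.

Lemma Re_le_Cmod_succ (b : C) : (0 < Re b)%R -> (Cmod b <= Cmod (b + 1))%R.
Proof.
intros Hb. unfold Cmod. apply sqrt_le_1_alt. simpl. unfold Re in Hb. nra.
Qed.

(* The region |z| <= |alpha| |1 - z|, whose boundary passes through the saddle. *)
Lemma jacQ_bound (n : nat) (b z : C) : (0 < Re b)%R ->
  (INR n * Cmod z <= Cmod (b + 1) * Cmod (1 - z))%R ->
  (Cmod (jacQ n b z) <= INR (S n) * Cmod (1 - z) ^ n)%R.
Proof.
revert b. induction n as [|n IH]; intros b Hb H.
- simpl. rewrite Cmod_1. lra.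
- assert (N1 : b + 1 <> 0) by exact (plus_INR_neq_0 b 1 Hb).
  assert (Hb1 : (0 < Re (b + 1))%R) by (simpl; unfold Re in Hb; lra).
  assert (P1 : (0 < Cmod (b + 1))%R) by now apply Cmod_gt_0.
  pose proof (Re_le_Cmod_succ (b + 1) Hb1) as M1.
  pose proof (Cmod_ge_0 z) as Z0. pose proof (Cmod_ge_0 (1 - z)) as Z1.
  specialize (IH (b + 1) Hb1).
  rewrite S_INR in H.
  assert (IH' := IH ltac:(nra)).
  change (jacQ (S n) b z) with ((1 - z) ^ S n + INR (S n) * z / (b + 1) * jacQ n (b + 1) z).
  eapply Rle_trans; [apply Cmod_triangle|].
  rewrite Cmod_pow, Cmod_mult, Cmod_div, Cmod_mult, Cmod_R by exact N1.
  rewrite Rabs_pos_eq by apply pos_INR.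
  assert (E : (INR (S n) * Cmod z / Cmod (b + 1) <= Cmod (1 - z))%R).
  { apply Rmult_le_reg_r with (Cmod (b + 1)); [exact P1|].
    unfold Rdiv. rewrite Rmult_assoc, Rinv_l, S_INR by lra. lra. }
  assert (0 <= INR (S n) * Cmod z / Cmod (b + 1))%R.
  { apply Rmult_le_pos; [apply Rmult_le_pos; [apply pos_INR | exact Z0]|].
    now apply Rlt_le, Rinv_0_lt_compat. }
  rewrite (S_INR (S n)). simpl pow.
  pose proof (Rmult_le_compat _ _ _ _ ltac:(eassumption) (Cmod_ge_0 (jacQ n (b + 1) z)) E IH').
  lra.
Qed.

(** The factor 4 makes each multiplier of the recursion at most |1 - z|/4, and 3/2 times 1/4 stays
    below 1/2. This excludes zeros near z = 0, a point that the coordinate z = e^w does not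
    reach. *)
Lemma jacQ_near_pow (n : nat) (b z : C) : (0 < Re b)%R ->
  (4 * INR n * Cmod z <= Cmod (b + 1) * Cmod (1 - z))%R ->
  (Cmod (jacQ n b z - (1 - z) ^ n) <= / 2 * Cmod (1 - z) ^ n)%R.
Proof.
revert b. induction n as [|n IH]; intros b Hb H.
- simpl. replace (1 - 1) with (RtoC 0) by ring. rewrite Cmod_0. lra.
- assert (N1 : b + 1 <> 0) by exact (plus_INR_neq_0 b 1 Hb).
  assert (Hb1 : (0 < Re (b + 1))%R) by (simpl; unfold Re in Hb; lra).
  assert (P1 : (0 < Cmod (b + 1))%R) by now apply Cmod_gt_0.
  pose proof (Re_le_Cmod_succ (b + 1) Hb1) as M1.
  pose proof (Cmod_ge_0 z) as Z0. pose proof (Cmod_ge_0 (1 - z)) as Z1.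
  specialize (IH (b + 1) Hb1).
  rewrite S_INR in H.
  assert (IH' := IH ltac:(nra)).
  change (jacQ (S n) b z) with ((1 - z) ^ S n + INR (S n) * z / (b + 1) * jacQ n (b + 1) z).
  replace ((1 - z) ^ S n + INR (S n) * z / (b + 1) * jacQ n (b + 1) z - (1 - z) ^ S n)
    with (INR (S n) * z / (b + 1) * jacQ n (b + 1) z) by ring.
  rewrite Cmod_mult, Cmod_div, Cmod_mult, Cmod_R by exact N1.
  rewrite Rabs_pos_eq by apply pos_INR.
  assert (E : (INR (S n) * Cmod z / Cmod (b + 1) <= / 4 * Cmod (1 - z))%R).
  { apply Rmult_le_reg_r with (Cmod (b + 1)); [exact P1|].
    unfold Rdiv. rewrite Rmult_assoc, Rinv_l, S_INR by lra. lra. }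
  assert (0 <= INR (S n) * Cmod z / Cmod (b + 1))%R.
  { apply Rmult_le_pos; [apply Rmult_le_pos; [apply pos_INR | exact Z0]|].
    now apply Rlt_le, Rinv_0_lt_compat. }
  assert (B : (Cmod (jacQ n (b + 1) z) <= 3 / 2 * Cmod (1 - z) ^ n)%R).
  { replace (jacQ n (b + 1) z) with ((1 - z) ^ n + (jacQ n (b + 1) z - (1 - z) ^ n)) by ring.
    eapply Rle_trans; [apply Cmod_triangle|]. rewrite Cmod_pow. lra. }
  pose proof (Rmult_le_compat _ _ _ _ ltac:(eassumption) (Cmod_ge_0 (jacQ n (b + 1) z)) E B).
  assert (0 <= Cmod (1 - z) * Cmod (1 - z) ^ n)%R by (apply Rmult_le_pos; [exact Z1 | now apply pow_le]).
  simpl pow. lra.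
Qed.

(** * Growth of the Beta integral *)

Local Close Scope C_scope.
Local Open Scope R_scope.

(* The real part of b log b - b at b = X + iY. *)
Definition stirL (X Y : R) : R := X * (ln (X * X + Y * Y) / 2) - Y * atan (Y / X) - X.

Lemma ln_Cmod (X Y : R) : 0 < X -> ln (Cmod (X, Y)) = ln (X * X + Y * Y) / 2.
Proof.
intros HX. unfold Cmod; simpl.
replace (X * (X * 1) + Y * (Y * 1)) with (X * X + Y * Y) by ring.
assert (P : 0 < X * X + Y * Y) by nra.
rewrite <- (sqrt_sqrt (X * X + Y * Y)) at 2 by lra.
pose proof (sqrt_lt_R0 _ P). rewrite ln_mult by assumption. field.
Qed.

Lemma is_derive_stirL (X Y : R) : 0 < X ->
  is_derive (fun x => stirL x Y) X (ln (Cmod (X, Y))).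
Proof.
intros HX. rewrite ln_Cmod by exact HX. unfold stirL.
assert (P : 0 < X * X + Y * Y) by nra.
auto_derive; [repeat split; lra | field; repeat split; nra].
Qed.

Lemma ln_Cmod_mono (X X' Y : R) : 0 < X <= X' -> ln (Cmod (X, Y)) <= ln (Cmod (X', Y)).
Proof.
intros H. rewrite !ln_Cmod by lra.
apply Rmult_le_compat_r; [lra|]. apply ln_le; nra.
Qed.

(** The X-derivative of [stirL] is ln |b|, increasing in X. Unit differences of [stirL] thus bracket
    ln |b|, and products of consecutive b + k can be telescoped: a crude Stirling estimate without
    the Gamma function. *)
Lemma stirL_step (X Y : R) : 0 < X ->
  ln (Cmod (X, Y)) <= stirL (X + 1) Y - stirL X Y <= ln (Cmod (X + 1, Y)).
Proof.
intros HX.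
destruct (MVT_gen (fun x => stirL x Y) X (X + 1) (fun x => ln (Cmod (x, Y)))) as [c [Hc E]].
- rewrite Rmin_left by lra. intros; apply is_derive_stirL; lra.
- rewrite Rmin_left by lra. intros. apply continuity_pt_filterlim.
  apply (ex_derive_continuous (fun x => stirL x Y)). eexists; apply is_derive_stirL; lra.
- rewrite Rmin_left, Rmax_right in Hc by lra. rewrite E.
  replace (X + 1 - X) with 1 by ring. rewrite Rmult_1_r.
  split; apply ln_Cmod_mono; lra.
Qed.

Lemma stirL_scale (s X Y : R) : 0 < s -> 0 < X ->
  stirL (s * X) (s * Y) = s * stirL X Y + s * X * ln s.
Proof.
intros Hs HX. unfold stirL.
replace (s * X * (s * X) + s * Y * (s * Y)) with (s * s * (X * X + Y * Y)) by ring.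
rewrite !ln_mult by nra.
replace (s * Y / (s * X)) with (Y / X) by (field; lra). field.
Qed.

Lemma ln_fact_S (n : nat) : ln (INR (fact (S n))) = ln (INR (S n)) + ln (INR (fact n)).
Proof.
rewrite fact_simpl, mult_INR, ln_mult; [reflexivity | apply lt_0_INR; lia | apply INR_fact_lt_0].
Qed.

Lemma ln_le_sub_1 (x : R) : 0 < x -> ln x <= x - 1.
Proof.
intros Hx. pose proof (exp_ineq1_le (ln x)) as H. rewrite exp_ln in H by exact Hx. lra.
Qed.

(** Induction from 1/(m + 1) <= ln (1 + 1/m) <= 1/m. The polynomial loss is harmless, as only
    exponential rates are compared. *)
Lemma ln_fact_bounds (n : nat) : (1 <= n)%nat ->
  INR n * ln (INR n) - INR n <= ln (INR (fact n)) <= INR n * ln (INR n) - INR n + ln (INR n) + 1.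
Proof.
intros Hn. induction n as [|n IH]; [lia|].
destruct n as [|n].
- simpl. rewrite ln_1. lra.
- specialize (IH ltac:(lia)). rewrite ln_fact_S.
  set (m := S n) in *. assert (Hm : 0 < INR m) by (apply lt_0_INR; lia).
  rewrite S_INR.
  assert (U1 := ln_le_sub_1 ((INR m + 1) / INR m) ltac:(apply Rdiv_lt_0_compat; lra)).
  assert (U2 := ln_le_sub_1 (INR m / (INR m + 1)) ltac:(apply Rdiv_lt_0_compat; lra)).
  rewrite ln_div in U1, U2 by lra.
  assert (V1 : INR m * (ln (INR m + 1) - ln (INR m)) <= 1).
  { replace 1 with (INR m * ((INR m + 1) / INR m - 1)) at 2 by (field; lra).
    apply Rmult_le_compat_l; lra. }
  assert (V2 : (INR m + 1) * (ln (INR m) - ln (INR m + 1)) <= -1).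
  { replace (-1) with ((INR m + 1) * (INR m / (INR m + 1) - 1)) by (field; lra).
    apply Rmult_le_compat_l; lra. }
  lra.
Qed.

Lemma jacQ_1_S (n : nat) (b : C) : jacQ (S n) b 1 = (INR (S n) / (b + 1) * jacQ n (b + 1) 1)%C.
Proof. change (jacQ (S n) b 1) with ((1 - 1) ^ S n + INR (S n) * 1 / (b + 1) * jacQ n (b + 1) 1)%C.
rewrite Cpow_S. unfold Cdiv. ring.
Qed.

Lemma jacQ_1_neq_0 (n : nat) (b : C) : 0 < Re b -> jacQ n b 1 <> 0.
Proof.
revert b. induction n as [|n IH]; intros b Hb.
- simpl. intros E; apply RtoC_inj in E; lra.
- rewrite jacQ_1_S. apply Cmult_neq_0; [|apply IH; simpl; unfold Re in Hb; lra].
  apply Cmult_neq_0; [apply RtoC_INR_S_neq_0|].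
  apply Cinv_nz. exact (plus_INR_neq_0 b 1 Hb).
Qed.

(** At z = 1 the recursion collapses to the product n!/((b + 1)...(b + n)); each ln |b + k| is
    bracketed by [stirL_step] and the sum telescopes. *)
Lemma ln_jacQ_1_bounds (n : nat) (X Y : R) : 0 < X ->
  ln (INR (fact n)) - (stirL (X + INR n + 1) Y - stirL (X + 1) Y)
    <= ln (Cmod (jacQ n (X, Y) 1))
    <= ln (INR (fact n)) - (stirL (X + INR n) Y - stirL X Y).
Proof.
revert X. induction n as [|n IH]; intros X HX.
- simpl. rewrite Cmod_1, ln_1, !Rplus_0_r. lra.
- rewrite jacQ_1_S.
  assert (E1 : ((X, Y) + 1)%C = (X + 1, Y)) by (unfold Cplus; simpl; f_equal; ring).
  rewrite E1. specialize (IH (X + 1) ltac:(lra)).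
  assert (N : (X + 1, Y) <> RtoC 0) by (intros E; apply (f_equal fst) in E; simpl in E; lra).
  assert (P : 0 < INR (S n)) by (apply lt_0_INR; lia).
  assert (PC : 0 < Cmod (X + 1, Y)) by now apply Cmod_gt_0.
  rewrite Cmod_mult, Cmod_div, Cmod_R, (Rabs_pos_eq (INR (S n))) by (assumption || lra).
  rewrite ln_mult; [|now apply Rdiv_lt_0_compat | apply Cmod_gt_0, jacQ_1_neq_0; simpl; lra].
  rewrite ln_div by assumption. rewrite ln_fact_S, S_INR.
  pose proof (stirL_step X Y HX). pose proof (stirL_step (X + 1) Y ltac:(lra)).
  replace (X + (INR n + 1)) with (X + 1 + INR n) by ring.
  rewrite S_INR in P.
  lra.
Qed.

(** The exponential rate in the form in which the Beta integral yields it: scaling [stirL] by n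
    produces a term n ln n that cancels against n!, and the -1 comes from n! being about n^n
    e^(-n). *)
Definition crit_level (eta zeta : R) : R := exp (stirL eta zeta - stirL (eta + 1) zeta - 1).

Lemma exp_pow (x : R) (n : nat) : exp x ^ n = exp (INR n * x).
Proof.
induction n as [|n IH]; [simpl; now rewrite Rmult_0_l, exp_0|].
rewrite S_INR. simpl. rewrite IH, <- exp_plus. f_equal. ring.
Qed.

(* jacQ n b 1 / b is the Beta integral B(b, n+1). *)
Lemma beta_bounds (eta zeta : R) : 0 < eta ->
  exists k K : R, 0 < k /\ forall n : nat, (1 <= n)%nat ->
    let b := ((eta, zeta) * INR n + 1)%C in
    k * crit_level eta zeta ^ n <= INR n * Cmod (jacQ n b 1 / b) /\
    Cmod (jacQ n b 1 / b) <= K * INR n * crit_level eta zeta ^ n.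
Proof.
intros He.
set (a := Cmod (eta, zeta)).
assert (Ha : 0 < a).
{ apply Cmod_gt_0. intros E; apply (f_equal fst) in E; simpl in E; lra. }
(* In the lower bound, shifting the arguments of [stirL] to X and X + n leaves |X + iY| = n a over
   two factors, each at most |X + n + 2 + iY| <= n (a + 3); hence also the spare factor n in the
   claim. [exp 1] and the n of the upper bound come from [ln_fact_bounds]. *)
exists (a / (a + 3) ^ 2), (exp 1). split.
{ apply Rdiv_lt_0_compat; [exact Ha|]. apply pow_lt; lra. }
intros n Hn b.
assert (Pn : 1 <= INR n) by (apply (le_INR 1); lia).
set (X := INR n * eta). set (Y := INR n * zeta).
assert (HX : 0 < X) by (unfold X; nra).
assert (Eb : b = (X + 1, Y)) by (unfold b, X, Y; apply injective_projections; simpl; ring).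
assert (Nb : b <> 0) by (rewrite Eb; intros E; apply (f_equal fst) in E; simpl in E; lra).
assert (Pb : 0 < Cmod b) by now apply Cmod_gt_0.
assert (PQ : 0 < Cmod (jacQ n b 1)) by (apply Cmod_gt_0, jacQ_1_neq_0; rewrite Eb; simpl; lra).
rewrite Cmod_div by exact Nb.
assert (PB : 0 < Cmod (jacQ n b 1) / Cmod b) by now apply Rdiv_lt_0_compat.
assert (EL : ln (Cmod (jacQ n b 1) / Cmod b) = ln (Cmod (jacQ n b 1)) - ln (Cmod b)) by now apply ln_div.
set (B := Cmod (jacQ n b 1) / Cmod b) in *. rewrite Eb in EL.
pose proof (ln_jacQ_1_bounds n (X + 1) Y ltac:(lra)) as [L U].
pose proof (ln_fact_bounds n Hn) as [FL FU].
pose proof (stirL_step X Y HX) as [S0l S0u].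
pose proof (stirL_step (X + 1) Y ltac:(lra)) as [S1l S1u].
pose proof (stirL_step (X + INR n) Y ltac:(lra)) as [Snl Snu].
pose proof (stirL_step (X + INR n + 1) Y ltac:(lra)) as [Snl' Snu'].
replace (X + 1 + INR n) with (X + INR n + 1) in L, U by ring.
replace (X + INR n + 1 + 1) with (X + INR n + 2) in * by ring.
replace (X + 1 + 1) with (X + 2) in * by ring.
assert (Esc : stirL (X + INR n) Y - stirL X Y
   = INR n * (stirL (eta + 1) zeta - stirL eta zeta) + INR n * ln (INR n)).
{ replace (X + INR n) with (INR n * (eta + 1)) by (unfold X; ring).
  unfold X, Y. rewrite !stirL_scale by lra. ring. }
assert (Pos : 0 <= ln (Cmod (X + INR n, Y))).
{ rewrite <- ln_1. apply ln_le; [lra|].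
  eapply Rle_trans; [|apply (re_le_Cmod (X + INR n, Y))]. simpl. rewrite Rabs_pos_eq; lra. }
assert (La : ln (Cmod (X, Y)) = ln (INR n) + ln a).
{ rewrite <- (ln_mult (INR n) a) by lra. unfold a. f_equal.
  rewrite <- (Rabs_pos_eq (INR n)) by lra. rewrite <- Cmod_R, <- Cmod_mult. f_equal.
  unfold X, Y, Cmult; simpl. f_equal; ring. }
assert (Lu : ln (Cmod (X + INR n + 2, Y)) <= ln (INR n) + ln (a + 3)).
{ rewrite <- ln_mult by lra. apply ln_le.
  - apply Cmod_gt_0. intros E; apply (f_equal fst) in E; simpl in E; lra.
  - replace (X + INR n + 2, Y) with (INR n * (eta, zeta) + RtoC (INR n + 2))%C
      by (unfold X, Y; apply injective_projections; simpl; ring).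
    eapply Rle_trans; [apply Cmod_triangle|].
    rewrite Cmod_mult, !Cmod_R, !Rabs_pos_eq by lra. fold a. lra. }
pose proof (ln_Cmod_mono (X + INR n + 1) (X + INR n + 2) Y ltac:(lra)) as M1.
unfold crit_level. rewrite exp_pow.
split.
- apply Rle_trans with (exp (ln a + (- ln (a + 3) + (- ln (a + 3)
      + INR n * (stirL eta zeta - stirL (eta + 1) zeta - 1))))).
  + rewrite !exp_plus, !exp_Ropp, !exp_ln by lra. right. field. lra.
  + replace (INR n * B) with (exp (ln (INR n) + ln B)) by (rewrite exp_plus, !exp_ln by lra; ring).
    apply exp_mono. lra.
- replace B with (exp (ln B)) by (now apply exp_ln).
  replace (exp 1 * INR n) with (exp (1 + ln (INR n))) by (rewrite exp_plus, exp_ln by lra; ring).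
  rewrite <- exp_plus. apply exp_mono. lra.
Qed.

Lemma crit_level_pos (eta zeta : R) : 0 < crit_level eta zeta.
Proof. apply exp_pos. Qed.

(** * Continuity, and descent of |q| *)

Local Open Scope C_scope.

Definition nearC (w : C) (P : C -> Prop) : Prop :=
  exists d : R, (0 < d)%R /\ forall u, (Cmod (u - w) < d)%R -> P u.

Lemma nearC_and (w : C) (P Q : C -> Prop) :
  nearC w P -> nearC w Q -> nearC w (fun u => P u /\ Q u).
Proof.
intros [d [Hd HP]] [e [He HQ]]. exists (Rmin d e). split; [now apply Rmin_pos|].
intros u Hu. pose proof (Rmin_l d e). pose proof (Rmin_r d e).
split; [apply HP | apply HQ]; lra.
Qed.

Lemma nearC_impl (w : C) (P Q : C -> Prop) :
  (forall u, P u -> Q u) -> nearC w P -> nearC w Q.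
Proof. intros H [d [Hd HP]]. exists d; split; auto. Qed.

Lemma nearC_point (w : C) (P : C -> Prop) : nearC w P -> P w.
Proof.
intros [d [Hd HP]]. apply HP. replace (w - w) with (RtoC 0) by ring. now rewrite Cmod_0.
Qed.

Definition Ccont (F : C -> C) (w : C) : Prop :=
  forall e : R, (0 < e)%R -> nearC w (fun u => Cmod (F u - F w) < e).

Lemma Ccont_const (c w : C) : Ccont (fun _ => c) w.
Proof.
intros e He. exists 1%R; split; [lra|]. intros u _.
replace (c - c) with (RtoC 0) by ring. now rewrite Cmod_0.
Qed.

Lemma Ccont_id (w : C) : Ccont (fun u => u) w.
Proof. intros e He. exists e; split; auto. Qed.

Lemma Ccont_plus (F G : C -> C) (w : C) :
  Ccont F w -> Ccont G w -> Ccont (fun u => F u + G u) w.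
Proof.
intros HF HG e He.
generalize (nearC_and _ _ _ (HF (e / 2)%R ltac:(lra)) (HG (e / 2)%R ltac:(lra))).
apply nearC_impl. intros u [H1 H2].
replace (F u + G u - (F w + G w)) with ((F u - F w) + (G u - G w)) by ring.
eapply Rle_lt_trans; [apply Cmod_triangle | lra].
Qed.

Lemma Ccont_mult (F G : C -> C) (w : C) :
  Ccont F w -> Ccont G w -> Ccont (fun u => F u * G u) w.
Proof.
intros HF HG e He.
set (A := (Cmod (F w) + Cmod (G w) + 1)%R).
pose proof (Cmod_ge_0 (F w)) as PF. pose proof (Cmod_ge_0 (G w)) as PG.
assert (HA : (1 <= A)%R) by (unfold A; lra).
set (d := Rmin 1 (e / (2 * A))).
assert (Pd : (0 < d)%R) by (apply Rmin_pos; [lra | apply Rdiv_lt_0_compat; lra]).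
assert (D1 : (d <= 1)%R) by apply Rmin_l.
assert (D2 : (d * A <= e / 2)%R).
{ apply Rle_trans with (e / (2 * A) * A)%R; [|right; field; lra].
  apply Rmult_le_compat_r; [lra | apply Rmin_r]. }
generalize (nearC_and _ _ _ (HF d Pd) (HG d Pd)).
apply nearC_impl. intros u [H1 H2].
replace (F u * G u - F w * G w)
  with ((F u - F w) * (G u - G w) + ((F u - F w) * G w + F w * (G u - G w))) by ring.
eapply Rle_lt_trans; [apply Cmod_triangle|].
eapply Rle_lt_trans; [apply Rplus_le_compat_l, Cmod_triangle|].
rewrite !Cmod_mult.
pose proof (Cmod_ge_0 (F u - F w)). pose proof (Cmod_ge_0 (G u - G w)).
assert (Cmod (F u - F w) * Cmod (G u - G w) <= d * 1)%R by (apply Rmult_le_compat; lra).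
assert (Cmod (F u - F w) * Cmod (G w) <= d * Cmod (G w))%R by (apply Rmult_le_compat_r; lra).
assert (Cmod (F w) * Cmod (G u - G w) <= Cmod (F w) * d)%R by (apply Rmult_le_compat_l; lra).
unfold A in D2. lra.
Qed.

Lemma Ccont_opp (F : C -> C) (w : C) : Ccont F w -> Ccont (fun u => - F u) w.
Proof.
intros HF e He. generalize (HF e He). apply nearC_impl. intros u H.
replace (- F u - - F w) with (- (F u - F w)) by ring. now rewrite Cmod_opp.
Qed.

Lemma Ccont_minus (F G : C -> C) (w : C) :
  Ccont F w -> Ccont G w -> Ccont (fun u => F u - G u) w.
Proof. intros HF HG. apply Ccont_plus; [|apply Ccont_opp]; assumption. Qed.

Lemma Ccont_conj (F : C -> C) (w : C) : Ccont F w -> Ccont (fun u => Cconj (F u)) w.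
Proof.
intros HF e He. generalize (HF e He). apply nearC_impl. intros u H.
now rewrite <- Cminus_conj, Cmod_conj.
Qed.

Lemma Ccont_inv (F : C -> C) (w : C) : F w <> 0 -> Ccont F w -> Ccont (fun u => / F u) w.
Proof.
intros Hn HF e He. set (m := Cmod (F w)). assert (Pm : (0 < m)%R) by now apply Cmod_gt_0.
assert (Pe : (0 < e * m * m / 2)%R) by (repeat apply Rmult_lt_0_compat; lra).
generalize (nearC_and _ _ _ (HF (m / 2)%R ltac:(lra)) (HF _ Pe)).
apply nearC_impl. intros u [H1 H2].
assert (Lo : (m / 2 < Cmod (F u))%R).
{ assert (m <= Cmod (F u) + Cmod (F u - F w))%R; [|lra].
  unfold m. replace (F w) with (F u + - (F u - F w)) at 1 by ring.
  rewrite <- (Cmod_opp (F u - F w)). apply Cmod_triangle. }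
assert (Nu : F u <> 0) by (apply Cmod_gt_0; lra).
replace (/ F u - / F w) with (- (F u - F w) / (F u * F w)) by (field; now split).
rewrite Cmod_div, Cmod_opp, Cmod_mult by now apply Cmult_neq_0.
fold m. assert (Pp : (0 < Cmod (F u) * m)%R) by (apply Rmult_lt_0_compat; lra).
apply Rmult_lt_reg_r with (Cmod (F u) * m)%R; [exact Pp|].
unfold Rdiv. rewrite Rmult_assoc, Rinv_l, Rmult_1_r by lra.
assert (e * m * m / 2 <= e * (Cmod (F u) * m))%R; [|lra].
assert (e * m * (m / 2) <= e * m * Cmod (F u))%R; [|lra].
apply Rmult_le_compat_l; [apply Rmult_le_pos; lra | lra].
Qed.

Lemma Cmod_Cexp_sub_1 (h : C) : (Cmod h <= 1)%R -> (Cmod (Cexp h - 1) <= exp 1 * Cmod h)%R.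
Proof.
intros Hh. rewrite <- Cexp_0 at 1. replace (Cmod h) with (Cmod (h - 0)) by (f_equal; ring).
apply (mean_value_ineq Cexp Cexp). intros t Ht. split.
- eapply Cdiff_eq; [apply (Cdiff_exp (fun u => u)), Cdiff_id|]. ring.
- rewrite Cmod_Cexp. apply exp_mono. simpl.
  pose proof (re_le_Cmod h) as H. apply Rabs_le_between in H. unfold Re in H.
  rewrite !Rplus_0_l, Ropp_0, Rplus_0_r, Rmult_0_l, Rminus_0_r. nra.
Qed.

Lemma Ccont_exp (F : C -> C) (w : C) : Ccont F w -> Ccont (fun u => Cexp (F u)) w.
Proof.
intros HF e He. set (m := (Cmod (Cexp (F w)) * exp 1)%R).
assert (Pm : (0 < m)%R).
{ apply Rmult_lt_0_compat; [apply Cmod_gt_0, Cexp_neq_0 | apply exp_pos]. }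
assert (Pe : (0 < e / m)%R) by now apply Rdiv_lt_0_compat.
generalize (nearC_and _ _ _ (HF 1%R ltac:(lra)) (HF _ Pe)).
apply nearC_impl. intros u [H1 H2].
replace (Cexp (F u) - Cexp (F w)) with (Cexp (F w) * (Cexp (F u - F w) - 1)).
2: { unfold Cminus at 2. rewrite Cexp_plus, Cexp_opp. field. apply Cexp_neq_0. }
rewrite Cmod_mult.
apply Rle_lt_trans with (m * Cmod (F u - F w))%R.
- unfold m. rewrite Rmult_assoc. apply Rmult_le_compat_l; [apply Cmod_ge_0|].
  apply Cmod_Cexp_sub_1; lra.
- apply Rmult_lt_reg_r with (/ m)%R; [now apply Rinv_0_lt_compat|].
  replace (m * Cmod (F u - F w) * / m)%R with (Cmod (F u - F w)) by (field; lra). exact H2.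
Qed.

Lemma Ccont_Cmod (F : C -> C) (w : C) (e : R) : (0 < e)%R -> Ccont F w ->
  nearC w (fun u => Cmod (F w) - e < Cmod (F u) < Cmod (F w) + e)%R.
Proof.
intros He HF. generalize (HF e He). apply nearC_impl. intros u H.
pose proof (Cmod_triangle (F w) (F u - F w)) as T1.
pose proof (Cmod_triangle (F u) (- (F u - F w))) as T2. rewrite Cmod_opp in T2.
replace (F w + (F u - F w)) with (F u) in T1 by ring.
replace (F u + - (F u - F w)) with (F w) in T2 by ring. lra.
Qed.

Lemma near_Cmod_lt (F : C -> C) (w : C) (L : R) : (Cmod (F w) < L)%R -> Ccont F w ->
  nearC w (fun u => Cmod (F u) < L).
Proof.
intros HL HF. generalize (Ccont_Cmod F w (L - Cmod (F w))%R ltac:(lra) HF).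
apply nearC_impl. intros u; lra.
Qed.

Lemma near_Cmod_gt (F : C -> C) (w : C) (L : R) : (L < Cmod (F w))%R -> Ccont F w ->
  nearC w (fun u => L < Cmod (F u)).
Proof.
intros HL HF. generalize (Ccont_Cmod F w (Cmod (F w) - L)%R ltac:(lra) HF).
apply nearC_impl. intros u; lra.
Qed.

Lemma near_bounded (F : C -> C) (w : C) : Ccont F w ->
  nearC w (fun u => Cmod (F u) <= Cmod (F w) + 1).
Proof.
intros HF. generalize (near_Cmod_lt F w (Cmod (F w) + 1) ltac:(lra) HF).
apply nearC_impl. intros; lra.
Qed.

Lemma segment_in_ball (w a b : C) (d t : R) : (0 <= t <= 1)%R ->
  (Cmod (a - w) < d)%R -> (Cmod (b - w) < d)%R -> (Cmod (a + t * (b - a) - w) < d)%R.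
Proof.
intros Ht Ha Hb.
replace (a + t * (b - a) - w) with ((1 - t)%R * (a - w) + t * (b - w))
  by (rewrite RtoC_minus; ring).
eapply Rle_lt_trans; [apply Cmod_triangle|].
rewrite !Cmod_mult, !Cmod_R, !Rabs_pos_eq by lra.
destruct (Req_dec t 0) as [->|]; [lra|]. nra.
Qed.

(** * The function q and its descent directions *)

Definition qf (a w : C) : C := Cexp (a * w) * (1 - Cexp w).
Definition dqf (a w : C) : C := Cexp (a * w) * (a - (a + 1) * Cexp w).
(* The derivative of |qf|^2 at w in direction v is 2 Re (gradq a w * v). *)
Definition gradq (a w : C) : C := Cconj (qf a w) * dqf a w.

Lemma Cdiff_qf (a w : C) : Cdiff (qf a) w (dqf a w).
Proof.
eapply Cdiff_eq.
- apply Cdiff_mult; [apply (Cdiff_exp (fun u => a * u)), Cdiff_scal, Cdiff_id|].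
  apply Cdiff_minus; [apply Cdiff_const | apply (Cdiff_exp (fun u => u)), Cdiff_id].
- unfold dqf; cbv beta; ring.
Qed.

Lemma Ccont_scal_exp (a w : C) : Ccont (fun u => Cexp (a * u)) w.
Proof. apply (Ccont_exp (fun u => a * u)), Ccont_mult; [apply Ccont_const | apply Ccont_id]. Qed.

Lemma Ccont_Cexp (w : C) : Ccont Cexp w.
Proof. apply (Ccont_exp (fun u => u)), Ccont_id. Qed.

Lemma Ccont_qf (a w : C) : Ccont (qf a) w.
Proof.
apply Ccont_mult; [apply Ccont_scal_exp|].
apply Ccont_minus; [apply Ccont_const | apply Ccont_Cexp].
Qed.

Lemma Ccont_gradq (a w : C) : Ccont (gradq a) w.
Proof.
apply Ccont_mult; [apply Ccont_conj, Ccont_qf|].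
apply Ccont_mult; [apply Ccont_scal_exp|].
apply Ccont_minus; [apply Ccont_const|].
apply Ccont_mult; [apply Ccont_const | apply Ccont_Cexp].
Qed.

(** Working with |q|^2 keeps the real function differentiable even at zeros of q. *)
Lemma qf_descent (a w v : C) (k t : R) : (0 <= t <= 1)%R ->
  (forall s, (0 <= s <= 1)%R -> Re (gradq a (w + s * v) * v) <= - k) ->
  (Cmod (qf a (w + t * v)%C) ^ 2 <= Cmod (qf a w) ^ 2 - 2 * k * t)%R.
Proof.
intros Ht H.
set (g := fun s : R => (fst (qf a (w + s * v)%C) * fst (qf a (w + s * v)%C)
                    + snd (qf a (w + s * v)%C) * snd (qf a (w + s * v)%C))%R).
assert (G : forall s, g s = (Cmod (qf a (w + s * v)%C) ^ 2)%R).
{ intros s. rewrite Cmod2_alt. unfold g, Re, Im. ring. }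
assert (D : forall s, is_derive g s (2 * Re (gradq a (w + s * v) * v))%R).
{ intros s. destruct (Cdiff_qf a (w + s * v) w v s eq_refl) as [D1 D2].
  eapply is_derive_eq;
    [exact (Rderive_plus _ _ _ _ _ (Rderive_mult _ _ _ _ _ D1 D1) (Rderive_mult _ _ _ _ _ D2 D2))|].
  unfold gradq. generalize (qf a (w + s * v)) (dqf a (w + s * v)).
  intros [q1 q2] [d1 d2]. unfold Re; simpl. ring. }
destruct (MVT_gen g 0 t (fun s => 2 * Re (gradq a (w + s * v) * v))%R) as [c [Hc E]].
- intros x _. apply D.
- intros x _. apply continuity_pt_filterlim, (ex_derive_continuous g). eexists; apply D.
- rewrite Rmin_left, Rmax_right in Hc by lra.
  rewrite !G in E. replace (w + 0%R * v) with w in E by ring.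
  specialize (H c ltac:(lra)). nra.
Qed.

(** One steepest-descent vector, opposite to the conjugate of [gradq a u], serves all starting
    points near u with the same gain k. This uniformity is what compactness needs. *)
Lemma near_descent (a u : C) (r : R) : (0 < r)%R -> gradq a u <> 0 ->
  exists (v : C) (k : R), (0 < k)%R /\ (Cmod v < r)%R /\
    nearC u (fun w => forall s, (0 <= s <= 1)%R -> Re (gradq a (w + s * v) * v) <= - k).
Proof.
intros Hr Hg. set (S := gradq a u) in *. set (m := Cmod S).
assert (Pm : (0 < m)%R) by now apply Cmod_gt_0.
destruct (Ccont_gradq a u (m / 2)%R ltac:(lra)) as [d [Pd Hd]].
(* Then |v| = tau m = min(r, d)/4, so a segment starting within d/2 of u stays in the d-ball, where
   [gradq] moves by less than m/2: half of the decrease tau m^2 survives. *)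
set (tau := (Rmin r d / (4 * m))%R).
assert (PM : (0 < Rmin r d)%R) by now apply Rmin_pos.
assert (Pt : (0 < tau)%R) by (apply Rdiv_lt_0_compat; lra).
assert (Et : (tau * m = Rmin r d / 4)%R) by (unfold tau; field; lra).
pose proof (Rmin_l r d). pose proof (Rmin_r r d).
set (v := - tau * Cconj S).
assert (Ev : (Cmod v = tau * m)%R).
{ unfold v. rewrite Cmod_mult, Cmod_opp, Cmod_R, Cmod_conj, Rabs_pos_eq by lra. reflexivity. }
pose proof (Rmult_lt_0_compat _ _ (Rmult_lt_0_compat _ _ Pt Pm) Pm) as Ptm.
exists v, (tau * m * m / 2)%R. split; [lra|]. split; [lra|].
exists (d / 2)%R. split; [lra|]. intros w Hw s Hs.
assert (Hin : (Cmod (w + s * v - u) < d)%R).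
{ replace (w + s * v - u) with ((w - u) + s * v) by ring.
  eapply Rle_lt_trans; [apply Cmod_triangle|].
  rewrite Cmod_mult, Cmod_R, Rabs_pos_eq by lra. nra. }
specialize (Hd _ Hin). fold S in Hd.
replace (gradq a (w + s * v) * v) with (S * v + (gradq a (w + s * v) - S) * v) by ring.
assert (E1 : Re (S * v) = (- (tau * m * m))%R).
{ assert (H1 : (m * m = fst S * fst S + snd S * snd S)%R).
  { unfold m. pose proof (Cmod2_alt S) as Q. unfold Re, Im in Q. lra. }
  replace (tau * m * m)%R with (tau * (m * m))%R by ring. rewrite H1. unfold v, Re; simpl. ring. }
assert (E2 : (Re ((gradq a (w + s * v) - S) * v) <= tau * m * m / 2)%R).
{ eapply Rle_trans; [apply Rle_abs|]. eapply Rle_trans; [apply re_le_Cmod|].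
  rewrite Cmod_mult, Ev. pose proof (Rmult_lt_0_compat _ _ Pt Pm). nra. }
change (Re (S * v) + Re ((gradq a (w + s * v) - S) * v) <= - (tau * m * m / 2))%R.
lra.
Qed.

(** * Endpoint estimates and their propagation *)

Definition bpar (a : C) (n : nat) : C := a * INR n + 1.

(* In the coordinate z = e^w this is the incomplete Beta integral of u^(b-1) (1-u)^n from 0 to z. *)
Definition Fint (a : C) (n : nat) (w : C) : C :=
  Cexp (bpar a n * w) * jacQ n (bpar a n) (Cexp w) / bpar a n.

Definition betaB (a : C) (n : nat) : C := jacQ n (bpar a n) 1 / bpar a n.

Lemma Re_bpar (a : C) (n : nat) : (0 < Re a)%R -> (1 <= Re (bpar a n))%R.
Proof.
intros Ha. unfold bpar; simpl. unfold Re in Ha. pose proof (pos_INR n). nra.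
Qed.

Lemma bpar_neq_0 (a : C) (n : nat) : (0 < Re a)%R -> bpar a n <> 0.
Proof. intros Ha E. pose proof (Re_bpar a n Ha) as H. rewrite E in H. simpl in H. lra. Qed.

Lemma Cexp_bpar (a : C) (n : nat) (w : C) : Cexp (bpar a n * w) = Cexp w * Cexp (a * w) ^ n.
Proof.
rewrite Cexp_pow, <- Cexp_plus. f_equal. unfold bpar. ring.
Qed.

Lemma Fint_0 (a : C) (n : nat) : Fint a n 0 = betaB a n.
Proof. unfold Fint, betaB. rewrite Cmult_0_r, Cexp_0. unfold Cdiv. ring. Qed.

Lemma Cdiff_Fint (a : C) (n : nat) (w : C) : (0 < Re a)%R ->
  Cdiff (Fint a n) w (Cexp w * qf a w ^ n).
Proof.
intros Ha. pose proof (bpar_neq_0 a n Ha) as N. pose proof (Re_bpar a n Ha).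
apply Cdiff_ext with (fun u => / bpar a n * (Cexp (bpar a n * u) * jacQ n (bpar a n) (Cexp u))).
{ intros u. unfold Fint. field. exact N. }
eapply Cdiff_eq; [apply Cdiff_scal, Cdiff_jacQ; lra|].
rewrite Cexp_bpar. unfold qf. rewrite Cpow_mult_l. field. exact N.
Qed.

(** K may depend on the point: estimates are propagated one segment at a time, and each nonvanishing
    argument starts from a single point. *)
Definition close_at (a : C) (beta : nat -> C) (L : R) (w : C) : Prop :=
  exists K : R, (0 <= K)%R /\ forall n : nat, (1 <= n)%nat -> (Cmod (Fint a n w - beta n) <= K * L ^ n)%R.

Lemma Fint_segment (a : C) (n : nat) (L : R) (w w' : C) : (0 < Re a)%R ->
  (forall t, (0 <= t <= 1)%R -> Cmod (qf a (w + t * (w' - w))%C) <= L) ->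
  (Cmod (Fint a n w' - Fint a n w) <= exp (Rmax (Re w) (Re w')) * Cmod (w' - w) * L ^ n)%R.
Proof.
intros Ha HL.
replace (exp (Rmax (Re w) (Re w')) * Cmod (w' - w) * L ^ n)%R
  with (exp (Rmax (Re w) (Re w')) * L ^ n * Cmod (w' - w))%R by ring.
apply (mean_value_ineq (Fint a n) (fun w => Cexp w * qf a w ^ n)).
intros t Ht. split; [now apply Cdiff_Fint|].
rewrite Cmod_mult, Cmod_pow, Cmod_Cexp.
apply Rmult_le_compat; [apply Rlt_le, exp_pos | apply pow_le, Cmod_ge_0 | |].
- apply exp_mono. simpl. pose proof (Rmax_l (Re w) (Re w')). pose proof (Rmax_r (Re w) (Re w')).
  unfold Re in *. nra.
- apply pow_incr. split; [apply Cmod_ge_0 | now apply HL].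
Qed.

Lemma close_at_segment (a : C) (beta : nat -> C) (L : R) (w w' : C) : (0 < Re a)%R ->
  (forall t, (0 <= t <= 1)%R -> Cmod (qf a (w + t * (w' - w))%C) <= L) ->
  close_at a beta L w -> close_at a beta L w'.
Proof.
intros Ha HL [K [HK H]].
set (M := (exp (Rmax (Re w) (Re w')) * Cmod (w' - w))%R).
assert (PM : (0 <= M)%R) by (apply Rmult_le_pos; [apply Rlt_le, exp_pos | apply Cmod_ge_0]).
exists (K + M)%R. split; [lra|]. intros n Hn.
replace (Fint a n w' - beta n) with ((Fint a n w - beta n) + (Fint a n w' - Fint a n w)) by ring.
eapply Rle_trans; [apply Cmod_triangle|].
specialize (H n Hn). pose proof (Fint_segment a n L w w' Ha HL) as S. fold M in S. lra.
Qed.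

Definition close0 (a : C) : R -> C -> Prop := close_at a (fun _ => 0).
Definition close1 (a : C) : R -> C -> Prop := close_at a (betaB a).

(** [jacQ_bound] applies because n |a| <= |b + 1|; its factor n + 1 is absorbed by the division by
    b, as |b| >= n Re a + 1. *)
Lemma close0_region (a : C) (L : R) (w : C) : (0 < Re a)%R ->
  (Cmod (Cexp w) <= Cmod a * Cmod (1 - Cexp w))%R ->
  (Cmod (qf a w) <= L)%R -> close0 a L w.
Proof.
intros Ha Hr HL.
exists (exp (Re w) * (1 + / Re a))%R. split.
{ apply Rmult_le_pos; [apply Rlt_le, exp_pos|]. pose proof (Rinv_0_lt_compat _ Ha). lra. }
intros n Hn.
pose proof (bpar_neq_0 a n Ha) as N. pose proof (Re_bpar a n Ha) as B1.
assert (Pn : (1 <= INR n)%R) by (apply (le_INR 1); lia).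
assert (J : (Cmod (jacQ n (bpar a n) (Cexp w)) <= INR (S n) * Cmod (1 - Cexp w) ^ n)%R).
{ apply jacQ_bound; [lra|].
  apply Rle_trans with (INR n * Cmod a * Cmod (1 - Cexp w))%R.
  - rewrite Rmult_assoc. apply Rmult_le_compat_l; lra.
  - apply Rmult_le_compat_r; [apply Cmod_ge_0|].
    rewrite <- (Rabs_pos_eq (INR n)), <- Cmod_R, <- Cmod_mult by lra.
    unfold bpar, Cmod; apply sqrt_le_1_alt. simpl. unfold Re in Ha.
    assert (0 <= fst a * INR n)%R by (apply Rmult_le_pos; lra). nra. }
replace (Fint a n w - 0) with (Fint a n w) by ring.
unfold Fint. rewrite Cmod_div, Cmod_mult, Cexp_bpar, Cmod_mult, Cmod_Cexp by exact N.
rewrite Cmod_pow.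
assert (Pb : (Re a * INR n + 1 <= Cmod (bpar a n))%R).
{ eapply Rle_trans; [|apply re_le_Cmod]. eapply Rle_trans; [|apply Rle_abs].
  right. unfold bpar, Re; simpl; ring. }
assert (Pbb : (0 < Cmod (bpar a n))%R) by now apply Cmod_gt_0.
assert (Q : (INR (S n) <= (1 + / Re a) * Cmod (bpar a n))%R).
{ apply Rle_trans with ((1 + / Re a) * (Re a * INR n + 1))%R.
  - rewrite S_INR. pose proof (Rinv_0_lt_compat _ Ha).
    replace ((1 + / Re a) * (Re a * INR n + 1))%R
      with (INR n + 1 + Re a * INR n + / Re a)%R by (field; lra).
    assert (0 <= Re a * INR n)%R by (apply Rmult_le_pos; lra). lra.
  - apply Rmult_le_compat_l; [|exact Pb]. pose proof (Rinv_0_lt_compat _ Ha). lra. }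
apply Rmult_le_reg_r with (Cmod (bpar a n)); [exact Pbb|].
unfold Rdiv. rewrite Rmult_assoc, Rinv_l, Rmult_1_r by lra.
apply Rle_trans with (exp (Re w) * Cmod (Cexp (a * w)) ^ n * (INR (S n) * Cmod (1 - Cexp w) ^ n))%R.
{ apply Rmult_le_compat_l; [|exact J].
  apply Rmult_le_pos; [apply Rlt_le, exp_pos | apply pow_le, Cmod_ge_0]. }
replace (exp (Re w) * Cmod (Cexp (a * w)) ^ n * (INR (S n) * Cmod (1 - Cexp w) ^ n))%R
  with (exp (Re w) * (INR (S n) * Cmod (qf a w) ^ n))%R
  by (unfold qf; rewrite Cmod_mult, Rpow_mult_distr; ring).
replace (exp (Re w) * (1 + / Re a) * L ^ n * Cmod (bpar a n))%R
  with (exp (Re w) * ((1 + / Re a) * Cmod (bpar a n) * L ^ n))%R by ring.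
apply Rmult_le_compat_l; [apply Rlt_le, exp_pos|].
apply Rmult_le_compat; [apply pos_INR | apply pow_le, Cmod_ge_0 | exact Q|].
apply pow_incr. split; [apply Cmod_ge_0 | exact HL].
Qed.

(** At w = 0, that is z = 1, [Fint] equals [betaB] exactly and q vanishes, so every positive L is
    admissible nearby. *)
Lemma close1_near_0 (a : C) (L : R) : (0 < Re a)%R -> (0 < L)%R -> nearC 0 (close1 a L).
Proof.
intros Ha HL.
destruct (near_Cmod_lt (qf a) 0 L) as [d [Pd Hd]]; [|apply Ccont_qf|].
{ unfold qf. rewrite Cexp_0. replace (1 - 1) with (RtoC 0) by ring.
  now rewrite Cmult_0_r, Cmod_0. }
exists d. split; [exact Pd|]. intros w Hw.
apply (close_at_segment a (betaB a) L 0 w Ha).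
- intros t Ht. left. apply Hd. apply segment_in_ball; try assumption.
  replace (0 - 0) with (RtoC 0) by ring. now rewrite Cmod_0.
- exists 0%R. split; [lra|]. intros n _. rewrite Fint_0.
  replace (betaB a n - betaB a n) with (RtoC 0) by ring. rewrite Cmod_0. lra.
Qed.

Lemma Cmod2_sub_Cexp (w : C) :
  (Cmod (1 - Cexp w) ^ 2 = 1 - 2 * (exp (Re w) * cos (Im w)) + exp (Re w) ^ 2)%R.
Proof.
rewrite Cmod2_alt. unfold Re, Im; simpl.
pose proof (sin2_cos2 (snd w)) as E. unfold Rsqr in E. unfold Re, Im; simpl.
set (c := cos (snd w)) in *; set (s := sin (snd w)) in *; set (e := exp (fst w)).
replace (e * (e * 1))%R with (e * e * (s * s + c * c))%R by (rewrite E; ring). ring.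
Qed.

Lemma Cmod_qf (a w : C) :
  Cmod (qf a w) = (exp (Re a * Re w - Im a * Im w) * Cmod (1 - Cexp w))%R.
Proof. unfold qf. rewrite Cmod_mult, Cmod_Cexp. reflexivity. Qed.

(* On horizontal lines with nonpositive cosine |qf| is increasing, so these points are reached
   from w = -infinity, that is, from z = 0. *)
Lemma close0_left (a : C) (L : R) (w : C) : (0 < Re a)%R ->
  (cos (Im w) <= 0)%R -> (Cmod (qf a w) <= L)%R -> close0 a L w.
Proof.
intros Ha Hc HL.
assert (Na : (0 < Cmod a)%R).
{ apply Cmod_gt_0. intros E; rewrite E in Ha; simpl in Ha; lra. }
(* So far to the left that |e^w| <= |a|; as |1 - e^w| >= 1 on this line, [close0_region] applies
   there. *)
set (x0 := Rmin (Re w) (ln (Cmod a))).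
set (w0 := (x0, Im w) : C).
assert (H1 : forall x, (1 <= Cmod (1 - Cexp (x, Im w)))%R).
{ intros x.
  apply Rsqr_incr_0_var; [|apply Cmod_ge_0]. unfold Rsqr.
  pose proof (Cmod2_sub_Cexp (x, Im w)) as E. simpl in E. unfold Re, Im in E; simpl in E.
  pose proof (exp_pos x). unfold Re, Im in *. nra. }
assert (Mono : forall x, (x <= Re w)%R -> (Cmod (qf a (x, Im w)) <= L)%R).
{ intros x Hx. eapply Rle_trans; [|exact HL]. rewrite !Cmod_qf.
  assert (X : (exp x <= exp (Re w))%R) by now apply exp_mono.
  apply Rmult_le_compat; [apply Rlt_le, exp_pos | apply Cmod_ge_0 | |].
  - apply exp_mono. unfold Re, Im in *; simpl. nra.
  - apply Rsqr_incr_0_var; [|apply Cmod_ge_0]. unfold Rsqr.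
    pose proof (Cmod2_sub_Cexp (x, Im w)) as E. pose proof (Cmod2_sub_Cexp w) as E'.
    unfold Re, Im in *; simpl in *. pose proof (exp_pos x). nra. }
apply (close_at_segment a (fun _ => 0) L w0 w Ha).
- intros t Ht.
  replace (w0 + t * (w - w0)) with ((x0 + t * (Re w - x0))%R, Im w).
  2: { unfold w0, Re, Im; apply injective_projections; simpl; ring. }
  apply Mono. pose proof (Rmin_l (Re w) (ln (Cmod a))). fold x0 in H. nra.
- apply close0_region; [exact Ha | | apply Mono, Rmin_l].
  rewrite Cmod_Cexp. unfold w0 at 1, Re at 1; simpl.
  apply Rle_trans with (Cmod a).
  + rewrite <- (exp_ln (Cmod a)) by exact Na. apply exp_mono, Rmin_r.
  + rewrite <- (Rmult_1_r (Cmod a)) at 1. apply Rmult_le_compat_l; [lra | apply H1].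
Qed.

(** * The compactness argument *)

Lemma succ_neq_0 (a : C) : (0 < Re a)%R -> a + 1 <> 0.
Proof. exact (plus_INR_neq_0 a 1). Qed.

Lemma Re_pos_neq_0 (a : C) : (0 < Re a)%R -> a <> 0.
Proof. intros Ha E. rewrite E in Ha. simpl in Ha. lra. Qed.

Lemma gradq_eq_0 (a w : C) : (0 < Re a)%R -> gradq a w = 0 ->
  Cexp w = 1 \/ Cexp w = a / (a + 1).
Proof.
intros Ha E. pose proof (succ_neq_0 a Ha) as N.
destruct (classic (Cexp w = 1)) as [|N1]; [now left | right].
destruct (classic (a - (a + 1) * Cexp w = 0)) as [E2|N2].
- apply Cmult_cancel_l with (a + 1); [exact N|].
  replace ((a + 1) * (a / (a + 1))) with a by (field; exact N).
  replace ((a + 1) * Cexp w) with (a - (a - (a + 1) * Cexp w)) by ring. rewrite E2. ring.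
- exfalso. revert E. unfold gradq, dqf, qf.
  apply Cmult_neq_0; [|apply Cmult_neq_0; [apply Cexp_neq_0 | exact N2]].
  apply Cmod_gt_0. rewrite Cmod_conj. apply Cmod_gt_0.
  apply Cmult_neq_0; [apply Cexp_neq_0|].
  intros E. apply N1. replace (Cexp w) with (1 - (1 - Cexp w)) by ring. rewrite E. ring.
Qed.

Lemma close0_near_saddle (a w0 : C) (L : R) : (0 < Re a)%R -> Cexp w0 = a / (a + 1) ->
  (Cmod (qf a w0) < L)%R -> nearC w0 (close0 a L).
Proof.
intros Ha E0 HL. pose proof (succ_neq_0 a Ha) as N.
destruct (near_Cmod_lt (qf a) w0 L HL (Ccont_qf a w0)) as [d [Pd Hd]].
exists d. split; [exact Pd|]. intros w Hw.
assert (H0 : (Cmod (w0 - w0) < d)%R).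
{ replace (w0 - w0) with (RtoC 0) by ring. now rewrite Cmod_0. }
apply (close_at_segment a (fun _ => 0) L w0 w Ha).
- intros t Ht. left. apply Hd. now apply segment_in_ball.
- apply close0_region; [exact Ha | | now left]. rewrite E0.
  replace (1 - a / (a + 1)) with (/ (a + 1)) by (field; exact N).
  rewrite Cmod_div, Cmod_inv by exact N. apply Rle_refl.
Qed.

(** The counterexamples to the alternative at level L; the aim is to show that there are none. *)
Definition bad (a : C) (L : R) (w : C) : Prop :=
  (Rabs (Im w) <= PI)%R /\ (Cmod (qf a w) <= L)%R /\ ~ close0 a L w /\ ~ close1 a L w.

(** Boxes instead of discs, and one d for both radius and gain, fit the gauge form of compactness: a
    lower bound on the gauge is at once a lower bound on the gain. *)
Definition local_decrease (a : C) (L : R) (u : C) (d : R) : Prop :=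
  forall w, (Rabs (Re w - Re u) < d)%R -> (Rabs (Im w - Im u) < d)%R -> bad a L w ->
    exists w', bad a L w' /\ (Cmod (qf a w') ^ 2 <= Cmod (qf a w) ^ 2 - d)%R.

Lemma Cmod_lt_components (u w : C) (d : R) :
  (Rabs (Re w - Re u) < d / 2)%R -> (Rabs (Im w - Im u) < d / 2)%R -> (Cmod (w - u) < d)%R.
Proof.
intros H1 H2.
replace (w - u) with (RtoC (Re w - Re u) + Ci * RtoC (Im w - Im u)).
2: { unfold Re, Im; apply injective_projections; simpl; ring. }
eapply Rle_lt_trans; [apply Cmod_triangle|].
rewrite Cmod_mult, Cmod_Ci, !Cmod_R. lra.
Qed.

Lemma local_decrease_no_bad (a : C) (L : R) (u : C) :
  nearC u (fun w => ~ bad a L w) -> exists d, (0 < d)%R /\ local_decrease a L u d.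
Proof.
intros [d [Pd H]]. exists (d / 2)%R. split; [lra|].
intros w H1 H2 Hb. exfalso. apply (H w); [now apply Cmod_lt_components | exact Hb].
Qed.

Lemma Im_near (u : C) (e : R) : (0 < e)%R -> nearC u (fun w => Rabs (Im w - Im u) < e)%R.
Proof.
intros He. exists e. split; [exact He|]. intros w Hw.
eapply Rle_lt_trans; [|exact Hw].
eapply Rle_trans; [|apply Rmax_Cmod]. apply Rmax_r.
Qed.

Lemma near_cos_Im_neg (u : C) : (cos (Im u) < 0)%R -> nearC u (fun w => cos (Im w) < 0)%R.
Proof.
intros H.
destruct (continuity_cos (Im u) (- cos (Im u))%R ltac:(lra)) as [e [Pe He]].
generalize (Im_near u e Pe). apply nearC_impl. intros w Hw.
destruct (Req_dec (Im w) (Im u)) as [->|Hn]; [exact H|].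
specialize (He (Im w)). simpl in He. unfold Rdist in He.
assert (Rabs (cos (Im w) - cos (Im u)) < - cos (Im u))%R.
{ apply He. split; [split; [exact I | now apply not_eq_sym] | exact Hw]. }
apply Rabs_def2 in H0. lra.
Qed.

(** Near the edges of the strip, near 0 and near the saddle there is no bad point. Elsewhere a
    descent step from a bad point ends in a bad point: the segment lies in {|q| <= L}, so either
    estimate at its end would propagate back to its start. *)
Lemma local_decrease_exists (a w0 : C) (L : R) (u : C) :
  (0 < Re a)%R -> Cexp w0 = a / (a + 1) -> (Rabs (Im w0) < PI)%R ->
  (0 < L)%R -> L <> Cmod (qf a w0) -> (Rabs (Im u) <= PI)%R ->
  exists d, (0 < d)%R /\ local_decrease a L u d.
Proof.
intros Ha E0 I0 HL HLn Hu. pose proof PI_RGT_0 as Hpi.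
destruct (Req_dec (Rabs (Im u)) PI) as [Hup|Hup].
{ apply local_decrease_no_bad.
  assert (Hc : (cos (Im u) < 0)%R).
  { assert (cos (Rabs (Im u)) = -1)%R by (rewrite Hup; apply cos_PI).
    revert H. unfold Rabs; destruct (Rcase_abs (Im u)); [rewrite cos_neg|]; lra. }
  generalize (near_cos_Im_neg u Hc). apply nearC_impl. intros w Hw [_ [Hq [N0 _]]].
  apply N0, close0_left; [exact Ha | lra | exact Hq]. }
assert (Hu' : (Rabs (Im u) < PI)%R) by lra.
destruct (classic (u = 0)) as [->|Nu0].
{ apply local_decrease_no_bad. generalize (close1_near_0 a L Ha HL).
  apply nearC_impl. intros w H [_ [_ [_ N1]]]. now apply N1. }
destruct (classic (u = w0)) as [->|Nuw].
{ apply local_decrease_no_bad. destruct (Rlt_le_dec (Cmod (qf a w0)) L) as [Hlt|Hge].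
  - generalize (close0_near_saddle a w0 L Ha E0 Hlt).
    apply nearC_impl. intros w H [_ [_ [N0 _]]]. now apply N0.
  (* As L differs from the saddle level, it is strictly below it, and |q| > L around the saddle. *)
  - generalize (near_Cmod_gt (qf a) w0 L ltac:(lra) (Ccont_qf a w0)).
    apply nearC_impl. intros w H [_ [Hq _]]. lra. }
assert (Ng : gradq a u <> 0).
{ intros E. destruct (gradq_eq_0 a u Ha E) as [E1|E1].
  - apply Nu0, Cexp_eq_1; [exact E1 | lra].
  - apply Nuw, Cexp_inj; [congruence|].
    eapply Rle_lt_trans; [apply Rabs_triang|]. rewrite Rabs_Ropp. lra. }
(* Half the distance to the edge for the starting point and half for the step: the new point stays
   in the strip. *)
set (m := ((PI - Rabs (Im u)) / 2)%R). assert (Pm : (0 < m)%R) by (unfold m; lra).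
destruct (near_descent a u m Pm Ng) as [v [k [Pk [Hv Hd]]]].
destruct (nearC_and _ _ _ Hd (Im_near u m Pm)) as [d [Pd H]].
set (e := Rmin (d / 2) (2 * k)). assert (Pe : (0 < e)%R) by (apply Rmin_pos; lra).
pose proof (Rmin_l (d / 2) (2 * k)) as El. pose proof (Rmin_r (d / 2) (2 * k)) as Er.
fold e in El, Er.
exists e. split; [exact Pe|]. intros w H1 H2 [Iw [Qw [N0 N1]]].
destruct (H w) as [Dw IIw]; [apply Cmod_lt_components; lra|].
assert (Seg : forall t, (0 <= t <= 1)%R -> (Cmod (qf a (w + t * v)%C) ^ 2 <= Cmod (qf a w) ^ 2 - 2 * k * t)%R).
{ intros t Ht. now apply qf_descent. }
assert (SegL : forall t, (0 <= t <= 1)%R -> (Cmod (qf a (w + t * v)%C) <= L)%R).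
{ intros t Ht. eapply Rle_trans; [|exact Qw].
  apply Rsqr_incr_0_var; [|apply Cmod_ge_0]. specialize (Seg t Ht).
  unfold Rsqr. assert (0 <= k * t)%R by (apply Rmult_le_pos; lra). nra. }
set (w' := w + v).
assert (Back : forall t, (0 <= t <= 1)%R -> (Cmod (qf a (w' + t * (w - w'))%C) <= L)%R).
{ intros t Ht. replace (w' + t * (w - w')) with (w + (1 - t)%R * v)
    by (unfold w'; rewrite RtoC_minus; ring). apply SegL; lra. }
exists w'. split.
- split; [|split; [|split]].
  + assert (Iv : (Rabs (Im v) < m)%R).
    { eapply Rle_lt_trans; [|exact Hv]. eapply Rle_trans; [|apply Rmax_Cmod]. apply Rmax_r. }
    replace (Im w') with (Im u + ((Im w - Im u) + Im v))%R by (unfold w', Im; simpl; ring).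
    eapply Rle_trans; [apply Rabs_triang|].
    eapply Rle_trans; [apply Rplus_le_compat_l, Rabs_triang|]. unfold m in *. lra.
  + replace w' with (w + 1%R * v) by (unfold w'; ring). apply SegL; lra.
  + intros A. apply N0. exact (close_at_segment a (fun _ => RtoC 0) L w' w Ha Back A).
  + intros A. apply N1. exact (close_at_segment a (betaB a) L w' w Ha Back A).
- specialize (Seg 1%R ltac:(lra)). replace (w + 1%R * v) with w' in Seg by (unfold w'; ring). lra.
Qed.

(** To the left, |z| (1 + |a|) < |a| forces |z| <= |a| |1 - z|, the region of the first estimate. To
    the right, Re w > 1 gives |1 - e^w| > 1, and the factor e^(a w) alone exceeds L. *)
Lemma bad_bounded (a : C) (L : R) : (0 < Re a)%R -> (0 < L)%R ->
  exists x1 x2 : R, forall w, bad a L w -> (x1 <= Re w <= x2)%R.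
Proof.
intros Ha HL. pose proof (Re_pos_neq_0 a Ha) as Na.
assert (Pa : (0 < Cmod a)%R) by now apply Cmod_gt_0.
exists (ln (Cmod a / (1 + Cmod a))), (Rmax 1 ((ln L + Rabs (Im a) * PI) / Re a)).
intros w [Iw [Qw [N0 _]]]. split.
- apply Rnot_lt_le. intros H. apply N0, close0_region; [exact Ha | | exact Qw].
  assert (E : (Cmod (Cexp w) < Cmod a / (1 + Cmod a))%R).
  { rewrite Cmod_Cexp, <- (exp_ln (Cmod a / (1 + Cmod a))) by (apply Rdiv_lt_0_compat; lra).
    now apply exp_increasing. }
  assert (T : (1 <= Cmod (1 - Cexp w) + Cmod (Cexp w))%R).
  { rewrite <- Cmod_1 at 1. replace (RtoC 1) with ((1 - Cexp w) + Cexp w) at 1 by ring.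
    apply Cmod_triangle. }
  assert (E' : (Cmod (Cexp w) * (1 + Cmod a) < Cmod a)%R).
  { apply Rmult_lt_reg_r with (/ (1 + Cmod a))%R; [apply Rinv_0_lt_compat; lra|].
    rewrite Rmult_assoc, Rinv_r, Rmult_1_r by lra. exact E. }
  nra.
- apply Rnot_lt_le. intros H.
  pose proof (Rmax_l 1 ((ln L + Rabs (Im a) * PI) / Re a)) as M1.
  pose proof (Rmax_r 1 ((ln L + Rabs (Im a) * PI) / Re a)) as M2.
  assert (G : (ln L + Rabs (Im a) * PI < Re a * Re w)%R).
  { apply Rmult_lt_reg_r with (/ Re a)%R; [now apply Rinv_0_lt_compat|].
    replace (Re a * Re w * / Re a)%R with (Re w) by (field; lra). unfold Rdiv in M2. lra. }
  assert (T : (exp (Re w) <= Cmod (1 - Cexp w) + 1)%R).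
  { rewrite <- Cmod_Cexp. replace (Cexp w) with (- (1 - Cexp w) + 1) at 1 by ring.
    eapply Rle_trans; [apply Cmod_triangle|]. rewrite Cmod_opp, Cmod_1. lra. }
  pose proof (exp_ineq1_le (Re w)) as X.
  assert (One : (1 < Cmod (1 - Cexp w))%R) by lra.
  assert (Y : (L < exp (Re a * Re w - Im a * Im w))%R).
  { rewrite <- (exp_ln L) by exact HL. apply exp_increasing.
    assert (Im a * Im w <= Rabs (Im a) * PI)%R; [|lra].
    eapply Rle_trans; [apply Rle_abs|]. rewrite Rabs_mult.
    apply Rmult_le_compat_l; [apply Rabs_pos | exact Iw]. }
  rewrite Cmod_qf in Qw. pose proof (exp_pos (Re a * Re w - Im a * Im w)). nra.
Qed.

(* By compactness a bad point of level |qf|^2 produces a bad point lower by a fixed amount,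
   which cannot be iterated for ever. *)
Lemma close0_or_close1 (a w0 : C) (L : R) (w : C) :
  (0 < Re a)%R -> Cexp w0 = a / (a + 1) -> (Rabs (Im w0) < PI)%R ->
  (0 < L)%R -> L <> Cmod (qf a w0) -> (Rabs (Im w) <= PI)%R -> (Cmod (qf a w) <= L)%R ->
  close0 a L w \/ close1 a L w.
Proof.
intros Ha E0 I0 HL HLn Iw Qw. apply NNPP. intros Hn.
assert (Hb : bad a L w) by (repeat split; try assumption; tauto).
destruct (bad_bounded a L Ha HL) as [x1 [x2 HB]].
assert (Hdelta : forall x y : R, exists d : posreal, (Rabs y <= PI)%R -> local_decrease a L (x, y) d).
{ intros x y. destruct (Rle_dec (Rabs y) PI) as [Hy|Hy].
  - destruct (local_decrease_exists a w0 L (x, y) Ha E0 I0 HL HLn Hy) as [d [Pd Hd]].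
    exists (mkposreal d Pd). now intros _.
  - exists (mkposreal 1 Rlt_0_1). tauto. }
set (delta := fun x y => proj1_sig (constructive_indefinite_description _ (Hdelta x y))).
assert (Hdel : forall x y, (Rabs y <= PI)%R -> local_decrease a L (x, y) (delta x y)).
{ intros x y. exact (proj2_sig (constructive_indefinite_description _ (Hdelta x y))). }
destruct (compactness_value_2d x1 x2 (- PI) PI delta) as [d Hd].
assert (Step : forall u, bad a L u ->
   exists u', bad a L u' /\ (Cmod (qf a u') ^ 2 <= Cmod (qf a u) ^ 2 - d)%R).
{ intros u Hu. pose proof (HB u Hu) as Hx.
  assert (Hy : (- PI <= Im u <= PI)%R) by (apply Rabs_le_between, Hu).
  (* The compactness lemma gives the covering box only under a double negation. *)
  destruct (NNPP _ (Hd (Re u) (Im u) Hx Hy)) as [x [y [_ [Hy' [D1 [D2 D3]]]]]].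
  destruct (Hdel x y (proj2 (Rabs_le_between _ _) Hy') u D1 D2 Hu) as [u' [Bu' Q']].
  exists u'. split; [exact Bu' | lra]. }
assert (Low : forall k u, bad a L u -> (INR k * d <= Cmod (qf a u) ^ 2)%R).
{ induction k as [|k IH]; intros u Hu.
  - simpl. rewrite Rmult_0_l. apply (pow_le (Cmod (qf a u)) 2), Cmod_ge_0.
  - destruct (Step u Hu) as [u' [Hu' Q']]. specialize (IH u' Hu'). rewrite S_INR. lra. }
destruct (INR_unbounded (Cmod (qf a w) ^ 2 / d)) as [k Hk].
specialize (Low k w Hb). pose proof (cond_pos d) as Pd.
apply (Rmult_lt_compat_r d) in Hk; [|exact Pd].
unfold Rdiv in Hk. rewrite Rmult_assoc, Rinv_l in Hk; lra.
Qed.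

(** * Two terms of the endpoint expansion *)

(** Bernoulli's inequality for 1/s = 1 + d, where s = (1 + r)/2 replaces r because r may be 0. *)
Lemma INR_geom_bounded (r : R) : (0 <= r < 1)%R ->
  exists K : R, (0 <= K)%R /\ forall n : nat, (INR n * r ^ n <= K)%R.
Proof.
intros Hr. set (s := ((1 + r) / 2)%R).
assert (Hs : (r <= s < 1)%R) by (unfold s; lra). assert (Ps : (0 < s)%R) by (unfold s; lra).
set (d := (/ s - 1)%R).
assert (Pd : (0 < d)%R).
{ unfold d. assert (1 < / s)%R; [|lra]. rewrite <- Rinv_1. apply Rinv_lt_contravar; lra. }
assert (Es : s = (/ (1 + d))%R) by (unfold d; field; lra).
exists (/ d)%R. split; [left; now apply Rinv_0_lt_compat|]. intros n.
pose proof (pos_INR n) as Pn.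
apply Rle_trans with (INR n * s ^ n)%R.
{ apply Rmult_le_compat_l; [exact Pn|]. apply pow_incr; lra. }
pose proof (poly n d Pd) as B.
rewrite Es, pow_inv.
assert (P : (0 < (1 + d) ^ n)%R) by (apply pow_lt; lra).
apply Rmult_le_reg_r with ((1 + d) ^ n)%R; [exact P|].
rewrite Rmult_assoc, Rinv_l, Rmult_1_r by lra.
apply Rmult_le_reg_l with d; [exact Pd|].
rewrite <- Rmult_assoc, Rinv_r by lra. lra.
Qed.

Lemma INR2_geom_bounded (r : R) : (0 <= r < 1)%R ->
  exists K : R, (0 <= K)%R /\ forall n : nat, (INR n * INR n * r ^ n <= K)%R.
Proof.
intros Hr.
assert (Hs : (0 <= sqrt r < 1)%R).
{ split; [apply sqrt_pos|]. rewrite <- sqrt_1. apply sqrt_lt_1_alt. exact Hr. }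
destruct (INR_geom_bounded _ Hs) as [K [PK HK]].
exists (K * K)%R. split; [now apply Rmult_le_pos|]. intros n.
rewrite <- (sqrt_sqrt r) at 1 by lra. rewrite Rpow_mult_distr.
replace (INR n * INR n * (sqrt r ^ n * sqrt r ^ n))%R
  with ((INR n * sqrt r ^ n) * (INR n * sqrt r ^ n))%R by ring.
assert (0 <= INR n * sqrt r ^ n)%R.
{ apply Rmult_le_pos; [apply pos_INR | apply pow_le, sqrt_pos]. }
apply Rmult_le_compat; auto.
Qed.

(** This is z/(1 - z), chosen because q'/q = a - x and x' = x (1 + x): all derivatives below are
    polynomials in x and y, where 1/y = b - n x is the logarithmic derivative of [Ef]. *)
Definition xf (w : C) : C := Cexp w / (1 - Cexp w).
Definition yf (a : C) (n : nat) (w : C) : C := / (bpar a n - INR n * xf w).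
Definition Ef (a : C) (n : nat) (w : C) : C := Cexp w * qf a w ^ n.
(* Two terms of the endpoint expansion of Fint, relative to Ef. *)
Definition Af (a : C) (n : nat) (w : C) : C :=
  yf a n w - INR n * (xf w * (1 + xf w)) * (yf a n w * (yf a n w * yf a n w)).
Definition Rf (a : C) (n : nat) (w : C) : C :=
  INR n * (xf w * (1 + xf w) * (1 + 2 * xf w)) * (yf a n w * (yf a n w * yf a n w))
  + 3 * (INR n * (xf w * (1 + xf w)) * (yf a n w * yf a n w))
      * (INR n * (xf w * (1 + xf w)) * (yf a n w * yf a n w)).

Lemma Cdiff_xf (w : C) : 1 - Cexp w <> 0 -> Cdiff xf w (xf w * (1 + xf w)).
Proof.
intros N. eapply Cdiff_eq.
- apply Cdiff_mult; [apply (Cdiff_exp (fun u => u)), Cdiff_id|].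
  apply (Cdiff_inv (fun u => 1 - Cexp u)); [exact N|].
  apply Cdiff_minus; [apply Cdiff_const | apply (Cdiff_exp (fun u => u)), Cdiff_id].
- unfold xf. cbv beta. field. exact N.
Qed.

Lemma Cdiff_yf (a : C) (n : nat) (w : C) : 1 - Cexp w <> 0 -> bpar a n - INR n * xf w <> 0 ->
  Cdiff (yf a n) w (INR n * (xf w * (1 + xf w)) * (yf a n w * yf a n w)).
Proof.
intros N N2. eapply Cdiff_eq.
- apply (Cdiff_inv (fun u => bpar a n - INR n * xf u)); [exact N2|].
  apply Cdiff_minus; [apply Cdiff_const | apply Cdiff_scal, Cdiff_xf, N].
- unfold yf. cbv beta. field. exact N2.
Qed.

Lemma Cdiff_Ef (a : C) (n : nat) (w : C) : 1 - Cexp w <> 0 ->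
  Cdiff (Ef a n) w (Ef a n w * (bpar a n - INR n * xf w)).
Proof.
intros N. destruct n as [|n].
- eapply Cdiff_ext; [|eapply Cdiff_eq; [apply (Cdiff_exp (fun u => u)), Cdiff_id|]].
  + intros u. unfold Ef. simpl. ring.
  + unfold Ef, bpar. simpl. ring.
- eapply Cdiff_eq.
  + apply Cdiff_mult; [apply (Cdiff_exp (fun u => u)), Cdiff_id|].
    apply Cdiff_pow, Cdiff_qf.
  + cbv beta. unfold Ef, bpar. rewrite Cpow_S.
    replace (dqf a w) with (qf a w * (a - xf w)) by (unfold dqf, qf, xf; field; exact N).
    ring.
Qed.

(** [Fint] has derivative [Ef], and (Ef A)' = Ef (A/y + A'), so an exact A would solve A/y + A' = 1.
    Iterating A := y (1 - A') once from A = y gives [Af]; [Rf] is the remaining defect. *)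
Lemma Cdiff_expansion_error (a : C) (n : nat) (w : C) : (0 < Re a)%R ->
  1 - Cexp w <> 0 -> bpar a n - INR n * xf w <> 0 ->
  Cdiff (fun u => Fint a n u - Ef a n u * Af a n u) w (Ef a n w * Rf a n w).
Proof.
intros Ha N N2.
pose proof (Cdiff_xf w N) as Dx. pose proof (Cdiff_yf a n w N N2) as Dy.
eapply Cdiff_eq.
- apply Cdiff_minus; [apply Cdiff_Fint, Ha|].
  apply Cdiff_mult; [apply Cdiff_Ef, N|].
  apply Cdiff_minus; [exact Dy|].
  apply Cdiff_mult.
  + apply Cdiff_scal. apply Cdiff_mult; [exact Dx|].
    apply Cdiff_plus; [apply Cdiff_const | exact Dx].
  + apply Cdiff_mult; [exact Dy | apply Cdiff_mult; exact Dy].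
- cbv beta. fold (Ef a n w). unfold Af, Rf.
  assert (Ey : (bpar a n - INR n * xf w) * yf a n w = 1) by (unfold yf; field; exact N2).
  set (psi := bpar a n - INR n * xf w) in *. set (y := yf a n w) in *. set (x := xf w) in *.
  set (E := Ef a n w).
  assert (P : psi = / y).
  { apply Cmult_cancel_l with y.
    - intros Z. rewrite Z, Cmult_0_r in Ey. apply RtoC_inj in Ey. lra.
    - rewrite Cmult_comm, Ey. field. intros Z. rewrite Z, Cmult_0_r in Ey. apply RtoC_inj in Ey. lra. }
  rewrite P. field. intros Z. rewrite Z, Cmult_0_r in Ey. apply RtoC_inj in Ey. lra.
Qed.

Section Bounds.
Variables (a w : C) (n : nat) (X m : R).
Hypotheses (HX : (Cmod (xf w) <= X)%R) (Pm : (0 < m)%R) (Hm : (m <= Cmod (a - xf w))%R)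
  (Hn : (1 <= n)%nat) (Hn1 : (2 <= m * INR n)%R).

(** Since b = a n + 1, the quantity is n (a - x) + 1; the 1 costs at most half of m n >= 2. *)
Lemma psi_lower : (m * INR n / 2 <= Cmod (bpar a n - INR n * xf w))%R.
Proof.
assert (Pn : (1 <= INR n)%R) by (apply (le_INR 1); lia).
assert (T : (Cmod (INR n * (a - xf w)) <= Cmod (bpar a n - INR n * xf w) + 1)%R).
{ replace (INR n * (a - xf w)) with ((bpar a n - INR n * xf w) + (- (1))) by (unfold bpar; ring).
  eapply Rle_trans; [apply Cmod_triangle|]. rewrite Cmod_opp, Cmod_1. lra. }
rewrite Cmod_mult, Cmod_R, Rabs_pos_eq in T by lra. nra.
Qed.

Lemma psi_neq_0 : bpar a n - INR n * xf w <> 0.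
Proof. apply Cmod_gt_0. pose proof psi_lower. lra. Qed.

Lemma yf_upper : (Cmod (yf a n w) <= 2 / (m * INR n))%R.
Proof.
unfold yf. rewrite Cmod_inv by apply psi_neq_0.
replace (2 / (m * INR n))%R with (/ (m * INR n / 2))%R by (field; split; [|nra]; intros Z; rewrite Z in Hn1; lra).
apply Rinv_le_contravar; [lra | apply psi_lower].
Qed.

Lemma yf_lower : (/ (INR n * (Cmod a + X + 1)) <= Cmod (yf a n w))%R.
Proof.
assert (Pn : (1 <= INR n)%R) by (apply (le_INR 1); lia).
unfold yf. rewrite Cmod_inv by apply psi_neq_0.
apply Rinv_le_contravar; [apply Cmod_gt_0, psi_neq_0|].
unfold bpar. replace (a * INR n + 1 - INR n * xf w) with (INR n * (a - xf w) + 1) by ring.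
eapply Rle_trans; [apply Cmod_triangle|].
rewrite Cmod_mult, Cmod_R, Rabs_pos_eq, Cmod_1 by lra.
assert (Cmod (a - xf w) <= Cmod a + X)%R.
{ unfold Cminus. eapply Rle_trans; [apply Cmod_triangle|]. rewrite Cmod_opp. lra. }
nra.
Qed.

Let C1 : R := (X * (1 + X))%R.

Lemma c1_bound : (Cmod (xf w * (1 + xf w)) <= C1)%R.
Proof.
rewrite Cmod_mult. apply Rmult_le_compat; try apply Cmod_ge_0; [exact HX|].
eapply Rle_trans; [apply Cmod_triangle|]. rewrite Cmod_1. lra.
Qed.

(** The quantity c bounded here is y'. Both sizes needed later follow from it: [Af] is y (1 - c) and
    [Rf] is c (1 + 2x) y + 3 c^2. *)
Lemma correction_bound : (Cmod (INR n * (xf w * (1 + xf w)) * (yf a n w * yf a n w)) <= 4 * C1 / (m * m) / INR n)%R.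
Proof.
assert (Pn : (1 <= INR n)%R) by (apply (le_INR 1); lia).
pose proof (Cmod_ge_0 (xf w)).
rewrite !Cmod_mult, Cmod_R, Rabs_pos_eq by lra. rewrite <- Cmod_mult.
pose proof c1_bound as B. pose proof yf_upper as Y. pose proof (Cmod_ge_0 (yf a n w)) as Y0.
assert (YY : (Cmod (yf a n w) * Cmod (yf a n w) <= 2 / (m * INR n) * (2 / (m * INR n)))%R)
  by now apply Rmult_le_compat.
apply Rle_trans with (INR n * C1 * (2 / (m * INR n) * (2 / (m * INR n))))%R.
- apply Rmult_le_compat; [|now apply Rmult_le_pos| |exact YY].
  + apply Rmult_le_pos; [lra | apply Cmod_ge_0].
  + apply Rmult_le_compat_l; lra.
- right. field. split; lra.
Qed.

Lemma Rf_bound : (Cmod (Rf a n w) <= (8 * C1 * (1 + 2 * X) / (m * m * m) + 48 * C1 * C1 / (m * m * m * m)) / (INR n * INR n))%R.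
Proof.
assert (Pn : (1 <= INR n)%R) by (apply (le_INR 1); lia).
pose proof (Cmod_ge_0 (xf w)) as X0.
pose proof correction_bound as B. pose proof yf_upper as Y. pose proof (Cmod_ge_0 (yf a n w)) as Y0.
assert (PC : (0 <= C1)%R) by (unfold C1; apply Rmult_le_pos; lra).
set (c := INR n * (xf w * (1 + xf w)) * (yf a n w * yf a n w)) in *.
replace (Rf a n w) with (c * (1 + 2 * xf w) * yf a n w + 3 * c * c) by (unfold Rf, c; ring).
eapply Rle_trans; [apply Cmod_triangle|].
rewrite !Cmod_mult, Cmod_R, (Rabs_pos_eq 3) by lra.
assert (B2 : (Cmod (1 + 2 * xf w) <= 1 + 2 * X)%R).
{ eapply Rle_trans; [apply Cmod_triangle|]. rewrite Cmod_1, Cmod_mult, Cmod_R, Rabs_pos_eq by lra. lra. }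
pose proof (Cmod_ge_0 c) as c0.
set (Bc := (4 * C1 / (m * m) / INR n)%R) in *.
apply Rle_trans with (Bc * (1 + 2 * X) * (2 / (m * INR n)) + 3 * Bc * Bc)%R.
- apply Rplus_le_compat.
  + apply Rmult_le_compat; [apply Rmult_le_pos; [exact c0 | apply Cmod_ge_0] | exact Y0 | | exact Y].
    apply Rmult_le_compat; try assumption. apply Cmod_ge_0.
  + apply Rmult_le_compat; try lra. 
- unfold Bc. right. field. split; lra.
Qed.

Lemma Af_bounds : (8 * C1 / (m * m) <= INR n)%R ->
  (/ (2 * (Cmod a + X + 1)) / INR n <= Cmod (Af a n w) <= 3 / m)%R.
Proof.
intros Hn2.
assert (Pn : (1 <= INR n)%R) by (apply (le_INR 1); lia).
pose proof correction_bound as B. pose proof yf_upper as YU. pose proof yf_lower as YL.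
pose proof (Cmod_ge_0 (yf a n w)) as Y0. pose proof (Cmod_ge_0 a). pose proof (Cmod_ge_0 (xf w)).
set (c := INR n * (xf w * (1 + xf w)) * (yf a n w * yf a n w)) in *.
replace (Af a n w) with (yf a n w * (1 - c)) by (unfold Af, c; ring).
assert (Hc : (Cmod c <= / 2)%R).
{ eapply Rle_trans; [exact B|].
  apply Rmult_le_reg_r with (INR n); [lra|]. unfold Rdiv at 1. rewrite Rmult_assoc, Rinv_l by lra. lra. }
rewrite Cmod_mult.
assert (U : (Cmod (1 - c) <= 3 / 2)%R).
{ unfold Cminus. eapply Rle_trans; [apply Cmod_triangle|]. rewrite Cmod_opp, Cmod_1. lra. }
assert (V : (/ 2 <= Cmod (1 - c))%R).
{ assert (1 <= Cmod (1 - c) + Cmod c)%R; [|lra].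
  rewrite <- Cmod_1 at 1. replace (RtoC 1) with ((1 - c) + c) at 1 by ring. apply Cmod_triangle. }
split.
- apply Rle_trans with (/ (INR n * (Cmod a + X + 1)) * / 2)%R; [right; field; lra|].
  apply Rmult_le_compat; try assumption; [|lra].
  left. apply Rinv_0_lt_compat, Rmult_lt_0_compat; lra.
- apply Rle_trans with (2 / (m * INR n) * (3 / 2))%R.
  + apply Rmult_le_compat; try assumption. apply Cmod_ge_0.
  + replace (2 / (m * INR n) * (3 / 2))%R with (3 / m * / INR n)%R by (field; lra).
    rewrite <- (Rmult_1_r (3 / m)) at 2. apply Rmult_le_compat_l.
    * left. apply Rdiv_lt_0_compat; lra.
    * rewrite <- Rinv_1. apply Rinv_le_contravar; lra.
Qed.

End Bounds.

Lemma INR_eventually_ge (x : R) : exists N : nat, forall n, (N <= n)%nat -> (x <= INR n)%R.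
Proof.
destruct (INR_unbounded x) as [N HN]. exists N. intros n Hn. apply le_INR in Hn. lra.
Qed.

Lemma Ccont_xf (w : C) : 1 - Cexp w <> 0 -> Ccont xf w.
Proof.
intros N. apply Ccont_mult; [apply Ccont_Cexp|].
apply (Ccont_inv (fun u => 1 - Cexp u)); [exact N|].
apply Ccont_minus; [apply Ccont_const | apply Ccont_Cexp].
Qed.

(** Compare D = Fint - Ef Af at u near w and at a lower point w'. At w' both terms of D are
    exponentially smaller than |q(u)|^n; along the segment to u, D varies by O(|q(u)|^n / n^2); but
    |Ef Af| at u is at least a multiple of |q(u)|^n / n. So [Fint] cannot vanish at u for large
    n. *)
Lemma Fint_nonzero_near (a w : C) : (0 < Re a)%R -> Cexp w <> 1 -> gradq a w <> 0 ->
  nearC w (fun w' => (Cmod (qf a w') < Cmod (qf a w))%R ->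
             exists L, (0 <= L < Cmod (qf a w))%R /\ close0 a L w') ->
  exists N : nat, nearC w (fun u => forall n, (N <= n)%nat -> Fint a n u <> 0).
Proof.
intros Ha N1 Ng [r0 [Pr0 H0]].
assert (N : 1 - Cexp w <> 0).
{ intros E. apply N1. replace (Cexp w) with (1 - (1 - Cexp w)) by ring. rewrite E. ring. }
assert (Nax : a - xf w <> 0).
{ intros E. apply Ng. unfold gradq, dqf.
  replace (a - (a + 1) * Cexp w) with ((1 - Cexp w) * (a - xf w)) by (unfold xf; field; exact N).
  rewrite E. ring. }
set (H := Cmod (qf a w)).
assert (PH : (0 < H)%R).
{ apply Cmod_gt_0, Cmult_neq_0; [apply Cexp_neq_0 | exact N]. }
set (m := (Cmod (a - xf w) / 2)%R).
assert (Pm : (0 < m)%R) by (assert (0 < Cmod (a - xf w))%R by (now apply Cmod_gt_0); unfold m; lra).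
set (X := (Cmod (xf w) + 1)%R). set (M := (Cmod (Cexp w) + 1)%R).
set (mu := (Cmod (Cexp w) / 2)%R).
assert (Pe : (0 < Cmod (Cexp w))%R) by apply Cmod_gt_0, Cexp_neq_0.
set (G := (Cmod (gradq a w) + 1)%R).
pose proof (Cmod_ge_0 (gradq a w)) as PG. pose proof (Cmod_ge_0 (xf w)) as PX.
pose proof (Ccont_xf w N) as Cx.
assert (Near1 : nearC w (fun u =>
   (0 < Cmod (1 - Cexp u))%R /\ (Cmod (xf u) <= X)%R /\ (m < Cmod (a - xf u))%R /\
   (Cmod (Cexp u) <= M)%R /\ (mu < Cmod (Cexp u))%R /\ (Cmod (gradq a u) <= G)%R)).
{ repeat apply nearC_and.
  - apply near_Cmod_gt with (F := fun u => 1 - Cexp u); [now apply Cmod_gt_0|].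
    apply Ccont_minus; [apply Ccont_const | apply Ccont_Cexp].
  - now apply near_bounded.
  - apply near_Cmod_gt with (F := fun u => a - xf u); [change (m < Cmod (a - xf w))%R; unfold m in *; lra|].
    apply Ccont_minus; [apply Ccont_const | exact Cx].
  - apply near_bounded, Ccont_Cexp.
  - apply near_Cmod_gt; [unfold mu; lra | apply Ccont_Cexp].
  - apply near_bounded, Ccont_gradq. }
destruct Near1 as [d1 [Pd1 Hd1]].
clearbody m.
set (r := Rmin 1 (Rmin r0 d1) ).
assert (Pr : (0 < r)%R) by (apply Rmin_pos; [lra | now apply Rmin_pos]).
pose proof (Rmin_l 1 (Rmin r0 d1)) as R1. pose proof (Rmin_r 1 (Rmin r0 d1)) as R2.
pose proof (Rmin_l r0 d1). pose proof (Rmin_r r0 d1). fold r in R1, R2.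
destruct (near_descent a w r Pr Ng) as [v [k [Pk [Hv Hdesc]]]].
set (w' := w + v).
assert (Dw' : (Cmod (w' - w) < r)%R) by (replace (w' - w) with v by (unfold w'; ring); exact Hv).
assert (Hw' : (Cmod (qf a w') < H)%R).
{ assert (S : (Cmod (qf a (w + 1%R * v)%C) ^ 2 <= Cmod (qf a w) ^ 2 - 2 * k * 1)%R).
  { apply qf_descent; [lra|]. exact (nearC_point _ _ Hdesc). }
  replace (w + 1%R * v) with w' in S by (unfold w'; ring). fold H in S.
  apply Rsqr_incrst_0; [unfold Rsqr; lra | apply Cmod_ge_0 | lra]. }
destruct (H0 w' ltac:(lra) Hw') as [L [[PL HL] [K [PK HK]]]]. fold H in HL.
(* L1 controls both [Fint] and [Ef] at w'; L2 lies below |q(u)| for u near w, so L1^n / |q(u)|^n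
   decays at least like (L1/L2)^n, uniformly in u. *)
set (L1 := Rmax L (Cmod (qf a w'))). set (L2 := ((L1 + H) / 2)%R).
assert (HL1 : (L1 < H)%R) by (now apply Rmax_lub_lt).
assert (PL1 : (0 <= L1)%R) by (eapply Rle_trans; [exact PL | apply Rmax_l]).
assert (PL2 : (0 < L2)%R) by (unfold L2; lra).
assert (HL2 : (L2 < H)%R) by (unfold L2; lra).
set (q := (L1 / L2)%R).
assert (Hq : (0 <= q < 1)%R).
{ unfold q; split; [apply Rmult_le_pos; [exact PL1 | now apply Rlt_le, Rinv_0_lt_compat]|].
  apply Rmult_lt_reg_r with L2; [exact PL2|]. unfold Rdiv. rewrite Rmult_assoc, Rinv_l by lra.
  unfold L2; lra. }
destruct (INR2_geom_bounded q Hq) as [Kq [PKq HKq]].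
set (C1 := (X * (1 + X))%R).
set (K1 := (8 * C1 * (1 + 2 * X) / (m * m * m) + 48 * C1 * C1 / (m * m * m * m))%R).
set (K2 := (K + M * (3 / m))%R).
set (m0 := (/ (2 * (Cmod a + X + 1)))%R).
assert (PXX : (0 <= X)%R) by (unfold X; lra).
assert (PM0 : (0 < M)%R) by (unfold M; lra).
assert (PC1 : (0 <= C1)%R) by (unfold C1; apply Rmult_le_pos; lra).
assert (PK1 : (0 <= K1)%R).
{ unfold K1. apply Rplus_le_le_0_compat; (apply Rmult_le_pos;
   [repeat apply Rmult_le_pos; lra | left; apply Rinv_0_lt_compat; repeat apply Rmult_lt_0_compat; lra]). }
assert (Pm0 : (0 < m0)%R).
{ unfold m0. pose proof (Cmod_ge_0 a). apply Rinv_0_lt_compat. lra. }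
assert (Pmu : (0 < mu)%R) by (unfold mu; lra).
assert (PK2 : (0 <= K2)%R).
{ unfold K2. apply Rplus_le_le_0_compat; [exact PK|].
  apply Rmult_le_pos; [lra | left; apply Rdiv_lt_0_compat; lra]. }
(* The summands ensure in turn n >= 1, the hypothesis of [psi_lower], a correction of at most 1/2 in
   [Af_bounds], and the final contradiction after multiplication by n^2. *)
destruct (INR_eventually_ge (1 + 2 / m + 8 * C1 / (m * m)
   + (M * K1 * 2 + K2 * Kq + 1) / (mu * m0))) as [NN HNN].
exists NN.
assert (PkG : (0 < k / G)%R) by (apply Rdiv_lt_0_compat; unfold G; lra).
destruct Hdesc as [d2 [Pd2 Hd2]].
generalize (nearC_and _ _ _ (near_Cmod_gt (qf a) w L2 HL2 (Ccont_qf a w))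
  (ex_intro _ (Rmin r (Rmin d2 (k / G))) (conj (Rmin_pos _ _ Pr (Rmin_pos _ _ Pd2 PkG)) (fun u h => h)))).
apply nearC_impl. intros u [Qu Du] n Hn F0.
pose proof (Rmin_l r (Rmin d2 (k / G))). pose proof (Rmin_r r (Rmin d2 (k / G))).
pose proof (Rmin_l d2 (k / G)). pose proof (Rmin_r d2 (k / G)).
specialize (HNN n Hn).
assert (T1 : (0 < 2 / m)%R) by (apply Rdiv_lt_0_compat; lra).
assert (T2 : (0 <= 8 * C1 / (m * m))%R).
{ apply Rmult_le_pos; [lra | left; apply Rinv_0_lt_compat, Rmult_lt_0_compat; lra]. }
assert (PMK : (0 <= M * K1)%R) by (apply Rmult_le_pos; lra).
assert (PKK : (0 <= K2 * Kq)%R) by (apply Rmult_le_pos; lra).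
assert (Pmm : (0 < mu * m0)%R) by (apply Rmult_lt_0_compat; lra).
assert (T3 : (0 < (M * K1 * 2 + K2 * Kq + 1) / (mu * m0))%R) by (apply Rdiv_lt_0_compat; lra).
assert (Pn : (1 <= INR n)%R) by lra.
assert (Hn1 : (1 <= n)%nat) by (apply INR_le; simpl; lra).
assert (Hn2 : (2 <= m * INR n)%R).
{ replace 2%R with (m * (2 / m))%R by (field; lra). apply Rmult_le_compat_l; lra. }
assert (Seg : forall t, (0 <= t <= 1)%R -> (Cmod (w' + t * (u - w') - w) < r)%R).
{ intros t Ht. apply segment_in_ball; lra. }
(* The direction from u to w' is v + (w - u). The first part contributes at most -k to the slope,
   the second at most G (k / G) = k, so |q| does not increase towards w': [qf_descent] with gain
   0. *)
assert (SegQ : forall t, (0 <= t <= 1)%R -> (Cmod (qf a (w' + t * (u - w'))%C) <= Cmod (qf a u))%R).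
{ intros t Ht. set (v' := w' - u).
  assert (S : (Cmod (qf a (u + (1 - t)%R * v')%C) ^ 2 <= Cmod (qf a u) ^ 2 - 2 * 0 * (1 - t))%R).
  { apply qf_descent; [lra|]. intros s Hs.
    set (z := u + s * v').
    assert (Ez : z = (u + s * (w - u)) + s * v) by (unfold z, v', w'; ring).
    assert (Dz : (Cmod (z - w) < d1)%R).
    { replace z with (w' + (1 - s)%R * (u - w')) by (unfold z, v'; rewrite RtoC_minus; ring).
      eapply Rlt_le_trans; [apply Seg; lra | lra]. }
    replace (gradq a z * v') with (gradq a z * v + gradq a z * (w - u)) by (unfold v', w'; ring).
    assert (A1 : (Re (gradq a z * v) <= - k)%R).
    { rewrite Ez. apply Hd2; [|exact Hs].
          replace (u + s * (w - u) - w) with ((1 - s)%R * (u - w)) by (rewrite RtoC_minus; ring).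
      rewrite Cmod_mult, Cmod_R, Rabs_pos_eq by lra.
      pose proof (Cmod_ge_0 (u - w)). nra. }
    assert (A2 : (Re (gradq a z * (w - u)) <= k)%R).
    { eapply Rle_trans; [apply Rle_abs|]. eapply Rle_trans; [apply re_le_Cmod|].
      rewrite Cmod_mult. apply Rle_trans with (G * (k / G))%R.
      - apply Rmult_le_compat; try apply Cmod_ge_0; [apply Hd1, Dz|].
        replace (w - u) with (- (u - w)) by ring. rewrite Cmod_opp. lra.
      - right; field. unfold G; lra. }
    change (Re (gradq a z * v) + Re (gradq a z * (w - u)) <= - 0)%R. lra. }
  replace (u + (1 - t)%R * v') with (w' + t * (u - w')) in S by (unfold v'; rewrite RtoC_minus; ring).
  apply Rsqr_incr_0_var; [unfold Rsqr; lra | apply Cmod_ge_0]. }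
assert (Hball : forall z, (Cmod (z - w) < r)%R -> (Cmod (z - w) < d1)%R) by (intros; lra).
set (h := Cmod (qf a u)) in *.
assert (Phn : (0 < h ^ n)%R) by (apply pow_lt; lra).
assert (MV : (Cmod ((Fint a n u - Ef a n u * Af a n u) - (Fint a n w' - Ef a n w' * Af a n w'))
    <= M * h ^ n * (K1 / (INR n * INR n)) * Cmod (u - w'))%R).
{ apply (mean_value_ineq (fun u => Fint a n u - Ef a n u * Af a n u) (fun u => Ef a n u * Rf a n u)).
  intros t Ht. pose proof (Seg t Ht) as Dz. specialize (SegQ t Ht).
  set (z := w' + t * (u - w')) in *.
  destruct (Hd1 z (Hball z Dz)) as [Z1 [Z2 [Z3 [Z4 _]]]].
  split.
  - apply Cdiff_expansion_error; [exact Ha | now apply Cmod_gt_0|].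
    apply (psi_neq_0 a z n m); try assumption; lra.
  - rewrite Cmod_mult. unfold Ef. rewrite Cmod_mult, Cmod_pow.
    apply Rmult_le_compat; [apply Rmult_le_pos; [apply Cmod_ge_0 | apply pow_le, Cmod_ge_0] | apply Cmod_ge_0 | |].
    + apply Rmult_le_compat; [apply Cmod_ge_0 | apply pow_le, Cmod_ge_0 | exact Z4|].
      apply pow_incr. split; [apply Cmod_ge_0 | exact SegQ].
    + apply (Rf_bound a z n X m); try assumption; lra. }
assert (Duw : (Cmod (u - w') <= 2)%R).
{ replace (u - w') with ((u - w) + - (w' - w)) by ring.
  eapply Rle_trans; [apply Cmod_triangle|]. rewrite Cmod_opp. lra. }
destruct (Hd1 u ltac:(lra)) as [U1 [U2 [U3 [U4 [U5 _]]]]].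
destruct (Hd1 w' ltac:(lra)) as [W1 [W2 [W3 [W4 _]]]].
destruct (Af_bounds a u n X m U2 Pm ltac:(lra) Hn1 Hn2) as [AU _]; [fold C1; lra|].
destruct (Af_bounds a w' n X m W2 Pm ltac:(lra) Hn1 Hn2) as [_ AW]; [fold C1; lra|].
fold m0 in AU.
assert (Lower : (mu * m0 * h ^ n / INR n <= Cmod (Ef a n u * Af a n u))%R).
{ unfold Ef. rewrite !Cmod_mult, Cmod_pow. fold h.
  replace (mu * m0 * h ^ n / INR n)%R with (mu * h ^ n * (m0 / INR n))%R by (field; lra).
  apply Rmult_le_compat; [left; apply Rmult_lt_0_compat; lra | left; apply Rdiv_lt_0_compat; lra | | exact AU].
  apply Rmult_le_compat_r; lra. }
assert (Upper : (Cmod (Fint a n w' - Ef a n w' * Af a n w') <= K2 * L1 ^ n)%R).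
{ unfold Cminus. eapply Rle_trans; [apply Cmod_triangle|]. rewrite Cmod_opp.
  specialize (HK n Hn1). replace (Fint a n w' - 0) with (Fint a n w') in HK by ring.
  assert (L ^ n <= L1 ^ n)%R by (apply pow_incr; split; [exact PL | apply Rmax_l]).
  assert (Cmod (Ef a n w' * Af a n w') <= M * (3 / m) * L1 ^ n)%R.
  { unfold Ef. rewrite !Cmod_mult, Cmod_pow.
    replace (M * (3 / m) * L1 ^ n)%R with (M * L1 ^ n * (3 / m))%R by ring.
    apply Rmult_le_compat; [apply Rmult_le_pos; [apply Cmod_ge_0 | apply pow_le, Cmod_ge_0] | apply Cmod_ge_0 | | exact AW].
    apply Rmult_le_compat; [apply Cmod_ge_0 | apply pow_le, Cmod_ge_0 | exact W4|].
    apply pow_incr; split; [apply Cmod_ge_0 | apply Rmax_r]. }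
  assert (K * L ^ n <= K * L1 ^ n)%R by (apply Rmult_le_compat_l; assumption).
  unfold K2. lra. }
assert (Decay : (INR n * INR n * L1 ^ n <= Kq * h ^ n)%R).
{ replace L1 with (q * L2)%R by (unfold q; field; lra). rewrite Rpow_mult_distr, <- Rmult_assoc.
  apply Rmult_le_compat; [repeat apply Rmult_le_pos; try lra; apply pow_le; lra | apply pow_le; lra | apply HKq|].
  apply pow_incr; lra. }
rewrite F0 in MV.
assert (Tri : (Cmod (Ef a n u * Af a n u) <= M * h ^ n * (K1 / (INR n * INR n)) * 2 + K2 * L1 ^ n)%R).
{ set (A := Ef a n u * Af a n u) in *. set (B := Fint a n w' - Ef a n w' * Af a n w') in *.
  replace A with (- ((0 - A - B) + B)) by ring. rewrite Cmod_opp.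
  eapply Rle_trans; [apply Cmod_triangle|].
  apply Rplus_le_compat; [|exact Upper]. eapply Rle_trans; [exact MV|].
  apply Rmult_le_compat_l; [|exact Duw].
  repeat apply Rmult_le_pos; try lra. left. apply Rinv_0_lt_compat, Rmult_lt_0_compat; lra. }
assert (Fin : (mu * m0 * h ^ n / INR n * (INR n * INR n)
    <= (M * h ^ n * (K1 / (INR n * INR n)) * 2 + K2 * L1 ^ n) * (INR n * INR n))%R).
{ apply Rmult_le_compat_r; [apply Rmult_le_pos; lra | lra]. }
replace (mu * m0 * h ^ n / INR n * (INR n * INR n))%R with (mu * m0 * INR n * h ^ n)%R in Fin by (field; lra).
replace ((M * h ^ n * (K1 / (INR n * INR n)) * 2 + K2 * L1 ^ n) * (INR n * INR n))%R
  with (M * K1 * 2 * h ^ n + K2 * (INR n * INR n * L1 ^ n))%R in Fin by (field; lra).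
assert (Fin2 : (mu * m0 * INR n * h ^ n <= (M * K1 * 2 + K2 * Kq) * h ^ n)%R).
{ pose proof (Rmult_le_compat_l K2 _ _ PK2 Decay). lra. }
apply Rmult_le_reg_r in Fin2; [|exact Phn].
assert (Fin3 : (mu * m0 * ((M * K1 * 2 + K2 * Kq + 1) / (mu * m0)) <= mu * m0 * INR n)%R).
{ apply Rmult_le_compat_l; lra. }
replace (mu * m0 * ((M * K1 * 2 + K2 * Kq + 1) / (mu * m0)))%R with (M * K1 * 2 + K2 * Kq + 1)%R in Fin3
  by (field; lra).
lra.
Qed.

(** * The zeros off the level curve *)

(** The logarithm on the right half-plane. The arctangent matches [stirL] and, unlike the arccosine
    in [Carg], has a linear bound near v = 1. *)
Definition plog (v : C) : C := (ln (Cmod v), atan (Im v / Re v)).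

Lemma Cexp_plog (v : C) : (0 < Re v)%R -> Cexp (plog v) = v.
Proof.
intros Hv. destruct v as [x y]. unfold Re in Hv; simpl in Hv.
assert (P : (0 < Cmod (x, y))%R).
{ apply Cmod_gt_0. intros E; apply (f_equal fst) in E; simpl in E; lra. }
unfold plog, Cexp, Re, Im; simpl. rewrite exp_ln by exact P.
rewrite cos_atan, sin_atan.
assert (E : (Cmod (x, y) = x * sqrt (1 + (y / x)²))%R).
{ unfold Cmod; simpl.
  replace (x * (x * 1) + y * (y * 1))%R with (x * x * (1 + (y / x)²))%R
    by (unfold Rsqr; field; lra).
  rewrite sqrt_mult_alt, sqrt_square by nra. reflexivity. }
assert (S : (0 < sqrt (1 + (y / x)²))%R).
{ apply sqrt_lt_R0. pose proof (Rle_0_sqr (y / x)). lra. }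
rewrite E. f_equal; field; lra.
Qed.

Lemma Rabs_atan_le (t : R) : (Rabs (atan t) <= Rabs t)%R.
Proof.
assert (G : forall s, (0 <= s)%R -> (0 <= atan s <= s)%R).
{ intros s Hs.
  destruct (MVT_gen atan 0 s (fun x => / (1 + x²))%R) as [c [Hc E]].
  - intros x _. apply is_derive_atan.
  - intros x _. apply derivable_continuous_pt, derivable_pt_atan.
  - rewrite atan_0, !Rminus_0_r in E. rewrite E. pose proof (Rle_0_sqr c).
    assert (0 < / (1 + c²) <= 1)%R.
    { split; [apply Rinv_0_lt_compat; lra|]. rewrite <- Rinv_1. apply Rinv_le_contravar; lra. }
    nra. }
unfold Rabs at 2. destruct (Rcase_abs t) as [Ht|Ht].
- specialize (G (- t)%R ltac:(lra)). rewrite atan_opp in G. rewrite Rabs_left1; lra.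
- specialize (G t ltac:(lra)). rewrite Rabs_pos_eq; lra.
Qed.

Lemma plog_near_1 (d : R) : (0 < d)%R ->
  nearC 1 (fun v => Cexp (plog v) = v /\ Cmod (plog v) < d).
Proof.
(* The logarithm of the modulus and the argument are each at most 2 e, and 4 e < d; the 1/2 keeps v
   in the right half-plane, away from its edge. *)
intros Hd. set (e := Rmin (1 / 2) (d / 5)). exists e.
assert (Pe : (0 < e)%R) by (apply Rmin_pos; lra).
pose proof (Rmin_l (1 / 2) (d / 5)) as E1. pose proof (Rmin_r (1 / 2) (d / 5)) as E2.
fold e in E1, E2. split; [exact Pe|]. intros v Hv.
assert (Hre : (1 - e < Re v)%R).
{ pose proof (re_le_Cmod (v - 1)) as H. apply Rabs_le_between in H. unfold Re in *; simpl in H. lra. }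
assert (Him : (Rabs (Im v) < e)%R).
{ eapply Rle_lt_trans; [|exact Hv]. eapply Rle_trans; [|apply Rmax_Cmod].
  replace (Im v) with (snd (v - 1)) by (unfold Im; simpl; ring). apply Rmax_r. }
split; [apply Cexp_plog; lra|].
assert (M1 : (1 - e <= Cmod v)%R).
{ eapply Rle_trans; [|apply re_le_Cmod]. eapply Rle_trans; [|apply Rle_abs]. lra. }
assert (M2 : (Cmod v <= 1 + e)%R).
{ replace v with (1 + (v - 1)) by ring. eapply Rle_trans; [apply Cmod_triangle|]. rewrite Cmod_1. lra. }
replace (plog v) with (plog v - 0) by ring.
apply Rle_lt_trans with (Rabs (ln (Cmod v)) + Rabs (atan (Im v / Re v)))%R.
{ replace (plog v - 0) with (RtoC (ln (Cmod v)) + Ci * RtoC (atan (Im v / Re v))).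
  2: { apply injective_projections; simpl; ring. }
  eapply Rle_trans; [apply Cmod_triangle|]. rewrite Cmod_mult, Cmod_Ci, !Cmod_R. lra. }
assert (L : (Rabs (ln (Cmod v)) <= 2 * e)%R).
{ apply Rabs_le_between. pose proof (ln_le_sub_1 (Cmod v) ltac:(lra)).
  pose proof (ln_le_sub_1 (/ Cmod v) ltac:(apply Rinv_0_lt_compat; lra)) as I.
  rewrite ln_Rinv in I by lra.
  assert (/ Cmod v <= 1 + 2 * e)%R; [|lra].
  apply Rmult_le_reg_r with (Cmod v); [lra|]. rewrite Rinv_l by lra. nra. }
assert (A : (Rabs (atan (Im v / Re v)) <= 2 * e)%R).
{ eapply Rle_trans; [apply Rabs_atan_le|]. unfold Rdiv. rewrite Rabs_mult, Rabs_inv.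
  rewrite (Rabs_pos_eq (Re v)) by lra.
  apply Rmult_le_reg_r with (Re v); [lra|]. rewrite Rmult_assoc, Rinv_l by lra. nra. }
lra.
Qed.

(** Zeros near z must be lifted to points near [Clog z]. [Clog] itself does not do this when z is
    negative, since it jumps there. *)
Lemma Cexp_locally_onto (w : C) (d : R) : (0 < d)%R ->
  nearC (Cexp w) (fun z => exists u, Cexp u = z /\ (Cmod (u - w) < d)%R).
Proof.
intros Hd. destruct (plog_near_1 d Hd) as [e [Pe He]].
assert (Pw : (0 < Cmod (Cexp w))%R) by apply Cmod_gt_0, Cexp_neq_0.
exists (e * Cmod (Cexp w))%R. split; [now apply Rmult_lt_0_compat|]. intros z Hz.
destruct (He (z / Cexp w)) as [E1 E2].
- replace (z / Cexp w - 1) with ((z - Cexp w) / Cexp w) by (field; apply Cexp_neq_0).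
  rewrite Cmod_div by apply Cexp_neq_0.
  apply Rmult_lt_reg_r with (Cmod (Cexp w)); [exact Pw|].
  unfold Rdiv. rewrite Rmult_assoc, Rinv_l by lra. lra.
- exists (w + plog (z / Cexp w)). split.
  + rewrite Cexp_plus, E1. field. apply Cexp_neq_0.
  + now replace (w + plog (z / Cexp w) - w) with (plog (z / Cexp w)) by ring.
Qed.

Lemma nearC_locally (z : C) (P : C -> Prop) : nearC z P -> locally z P.
Proof.
intros [d [Pd H]]. assert (Pd2 : (0 < d / 2)%R) by lra.
exists (mkposreal _ Pd2). intros y [B1 B2]. apply H. apply Cmod_lt_components; assumption.
Qed.

(** log a - log (a + 1) with right half-plane branches: the preimage of a/(a + 1) inside the
    strip. *)
Definition saddle (a : C) : C :=
  ((ln (Cmod a) - ln (Cmod (a + 1)))%R, (atan (Im a / Re a) - atan (Im (a + 1) / Re (a + 1)))%R).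

Lemma Cexp_saddle (a : C) : (0 < Re a)%R -> Cexp (saddle a) = a / (a + 1).
Proof.
intros Ha. assert (Ha1 : (0 < Re (a + 1))%R) by (simpl; unfold Re in Ha; lra).
replace (saddle a) with (plog a + - plog (a + 1)).
2: { unfold saddle, plog. apply injective_projections; simpl; ring. }
rewrite Cexp_plus, Cexp_opp, !Cexp_plog by assumption. reflexivity.
Qed.

Lemma Im_saddle (a : C) : (Rabs (Im (saddle a)) < PI)%R.
Proof.
unfold saddle, Im at 1; simpl.
pose proof (atan_bound (Im a / Re a)). pose proof (atan_bound (Im (a + 1) / Re (a + 1))).
unfold Im, Re in *; simpl in *. apply Rabs_def1; lra.
Qed.

(** Both logarithms equal Re (a log a - (a + 1) log (a + 1)): the linear terms of the two [stirL]
    differ by 1, which cancels the -1 in [crit_level]. *)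
Lemma Cmod_qf_saddle (a : C) : (0 < Re a)%R -> Cmod (qf a (saddle a)) = crit_level (Re a) (Im a).
Proof.
intros Ha. assert (Ha1 : (0 < Re (a + 1))%R) by (simpl; unfold Re in Ha; lra).
pose proof (succ_neq_0 a Ha) as N.
rewrite Cmod_qf, Cexp_saddle by exact Ha.
replace (1 - a / (a + 1)) with (/ (a + 1)) by (field; exact N).
rewrite Cmod_inv by exact N.
rewrite <- (exp_ln (Cmod (a + 1))) by (now apply Cmod_gt_0). rewrite <- exp_Ropp, <- exp_plus.
unfold crit_level. f_equal. unfold stirL.
rewrite <- !ln_Cmod by lra.
replace (Re a, Im a) with a by (now destruct a).
replace ((Re a + 1)%R, Im a) with (a + 1)
  by (unfold Re, Im; apply injective_projections; simpl; ring).
replace (Im (a + 1)) with (Im a) by (unfold Im; simpl; ring).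
unfold saddle, Re at 2, Im at 2; simpl.
replace (Im (a + 1)) with (Im a) by (unfold Im; simpl; ring).
replace (fst a + 1)%R with (Re a + 1)%R by reflexivity.
rewrite ?Rplus_0_r. unfold Re, Im; simpl. rewrite ?Rplus_0_r. ring.
Qed.

Lemma betaB_bounds (a : C) : (0 < Re a)%R ->
  exists k K : R, (0 < k)%R /\ forall n : nat, (1 <= n)%nat ->
    (k * Cmod (qf a (saddle a)) ^ n <= INR n * Cmod (betaB a n))%R /\
    (Cmod (betaB a n) <= K * INR n * Cmod (qf a (saddle a)) ^ n)%R.
Proof.
intros Ha. destruct (beta_bounds (Re a) (Im a) Ha) as [k [K [Pk H]]].
exists k, K. split; [exact Pk|]. intros n Hn. specialize (H n Hn). cbv zeta in H.
rewrite Cmod_qf_saddle by exact Ha. unfold betaB, bpar.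
replace (Re a, Im a) with a in H by (now destruct a). exact H.
Qed.

Lemma qf_saddle_pos (a : C) : (0 < Re a)%R -> (0 < Cmod (qf a (saddle a)))%R.
Proof. intros Ha. rewrite Cmod_qf_saddle by exact Ha. apply crit_level_pos. Qed.

(** A whole neighbourhood is needed even when w lies on an edge of the strip; its points outside the
    strip are covered by [close0_left]. *)
Lemma near_close0_or_close1 (a w : C) : (0 < Re a)%R -> (Rabs (Im w) <= PI)%R ->
  nearC w (fun w' => forall L, (0 < L)%R -> L <> Cmod (qf a (saddle a)) ->
    (Cmod (qf a w') <= L)%R -> close0 a L w' \/ close1 a L w').
Proof.
intros Ha Hw. pose proof PI_RGT_0.
destruct (Req_dec (Rabs (Im w)) PI) as [E|E].
- assert (Hc : (cos (Im w) < 0)%R).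
  { assert (C : cos (Rabs (Im w)) = (-1)%R) by (rewrite E; apply cos_PI).
    revert C. unfold Rabs; destruct (Rcase_abs (Im w)); [rewrite cos_neg|]; lra. }
  generalize (near_cos_Im_neg w Hc). apply nearC_impl. intros w' Hw' L _ _ HL.
  left. apply close0_left; [exact Ha | lra | exact HL].
- generalize (Im_near w (PI - Rabs (Im w)) ltac:(lra)). apply nearC_impl.
  intros w' Hw' L PL NL HL.
  apply (close0_or_close1 a (saddle a)); try assumption; [now apply Cexp_saddle | apply Im_saddle|].
  replace (Im w') with (Im w + (Im w' - Im w))%R by ring.
  eapply Rle_trans; [apply Rabs_triang|]. lra.
Qed.

Lemma gradq_neq_0 (a w : C) : (0 < Re a)%R -> (Rabs (Im w) <= PI)%R -> Cexp w <> 1 ->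
  Cmod (qf a w) <> Cmod (qf a (saddle a)) -> gradq a w <> 0.
Proof.
intros Ha Hw N1 Nc E. destruct (gradq_eq_0 a w Ha E) as [E1|E1]; [contradiction|].
apply Nc. do 2 f_equal. apply Cexp_inj; [rewrite E1; symmetry; now apply Cexp_saddle|].
pose proof (Im_saddle a). eapply Rle_lt_trans; [apply Rabs_triang|]. rewrite Rabs_Ropp. lra.
Qed.

(** Above the saddle level the Beta integral, O(n c^n), is itself O(L^n). *)
Lemma close1_close0 (a : C) (L : R) (w : C) : (0 < Re a)%R ->
  (Cmod (qf a (saddle a)) < L)%R -> close1 a L w -> close0 a L w.
Proof.
intros Ha HL [K [PK H]]. pose proof (qf_saddle_pos a Ha) as P0.
set (c := Cmod (qf a (saddle a))) in *.
destruct (betaB_bounds a Ha) as [k [K' [_ HB]]]. fold c in HB.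
assert (Hq : (0 <= c / L < 1)%R).
{ split; [left; apply Rdiv_lt_0_compat; lra|].
  apply Rmult_lt_reg_r with L; [lra|]. unfold Rdiv. rewrite Rmult_assoc, Rinv_l; lra. }
destruct (INR_geom_bounded _ Hq) as [Q [PQ HQ]].
exists (K + Rabs K' * Q)%R. split.
{ pose proof (Rabs_pos K'). apply Rplus_le_le_0_compat; [exact PK | now apply Rmult_le_pos]. }
intros n Hn. specialize (H n Hn). destruct (HB n Hn) as [_ HU]. specialize (HQ n).
assert (PL : (0 < L ^ n)%R) by (apply pow_lt; lra).
assert (D : (INR n * c ^ n <= Q * L ^ n)%R).
{ replace c with (c / L * L)%R by (field; lra). rewrite Rpow_mult_distr, <- Rmult_assoc.
  apply Rmult_le_compat_r; [lra | exact HQ]. }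
assert (D0 : (0 <= INR n * c ^ n)%R) by (apply Rmult_le_pos; [apply pos_INR | apply pow_le; lra]).
replace (Fint a n w - 0) with ((Fint a n w - betaB a n) + betaB a n) by ring.
eapply Rle_trans; [apply Cmod_triangle|].
assert (Cmod (betaB a n) <= Rabs K' * (Q * L ^ n))%R; [|lra].
eapply Rle_trans; [exact HU|]. rewrite Rmult_assoc.
apply Rle_trans with (Rabs K' * (INR n * c ^ n))%R.
- apply Rmult_le_compat_r; [exact D0 | apply Rle_abs].
- apply Rmult_le_compat_l; [apply Rabs_pos | exact D].
Qed.

(** A zero at u near w would make [Fint] at w, hence [betaB], O(L^n), against the lower bound k c^n
    / n. *)
Lemma nonzero_of_close1 (a : C) (L : R) (w : C) : (0 < Re a)%R ->
  (0 < L < Cmod (qf a (saddle a)))%R -> (Cmod (qf a w) < L)%R -> close1 a L w ->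
  exists N : nat, nearC w (fun u => forall n, (N <= n)%nat -> Fint a n u <> 0).
Proof.
intros Ha HL Hw [K [PK H]]. set (c := Cmod (qf a (saddle a))) in *.
destruct (betaB_bounds a Ha) as [k [K' [Pk HB]]]. fold c in HB.
assert (Hq : (0 <= L / c < 1)%R).
{ split; [left; apply Rdiv_lt_0_compat; lra|].
  apply Rmult_lt_reg_r with c; [lra|]. unfold Rdiv. rewrite Rmult_assoc, Rinv_l; lra. }
destruct (INR2_geom_bounded _ Hq) as [Q [PQ HQ]].
set (M := (K + exp (Re w + 1))%R).
pose proof (exp_pos (Re w + 1)) as PE.
destruct (INR_eventually_ge (1 + (M * Q + 1) / k)) as [N HN].
exists N.
destruct (near_Cmod_lt (qf a) w L Hw (Ccont_qf a w)) as [d [Pd Hd]].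
exists (Rmin 1 d). split; [apply Rmin_pos; lra|]. intros u Hu n Hn F0.
pose proof (Rmin_l 1 d). pose proof (Rmin_r 1 d). specialize (HN n Hn).
assert (PMQ : (0 <= M * Q)%R) by (apply Rmult_le_pos; unfold M; lra).
assert (T : (0 < (M * Q + 1) / k)%R) by (apply Rdiv_lt_0_compat; lra).
assert (Hn1 : (1 <= n)%nat) by (apply INR_le; simpl; lra).
assert (S : (Cmod (Fint a n u - Fint a n w) <= exp (Rmax (Re w) (Re u)) * Cmod (u - w) * L ^ n)%R).
{ apply Fint_segment; [exact Ha|]. intros t Ht. left. apply Hd. apply segment_in_ball; [exact Ht | | lra].
  replace (w - w) with (RtoC 0) by ring. now rewrite Cmod_0. }
assert (PLn : (0 < L ^ n)%R) by (apply pow_lt; lra).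
assert (S2 : (exp (Rmax (Re w) (Re u)) * Cmod (u - w) <= exp (Re w + 1))%R).
{ rewrite <- (Rmult_1_r (exp (Re w + 1))).
  apply Rmult_le_compat; [left; apply exp_pos | apply Cmod_ge_0 | | lra].
  apply exp_mono, Rmax_lub; [lra|].
  pose proof (re_le_Cmod (u - w)) as R1. apply Rabs_le_between in R1. unfold Re in *; simpl in R1. lra. }
assert (S3 : (Cmod (Fint a n u - Fint a n w) <= exp (Re w + 1) * L ^ n)%R).
{ eapply Rle_trans; [exact S|]. apply Rmult_le_compat_r; lra. }
rewrite F0 in S3. specialize (H n Hn1). destruct (HB n Hn1) as [HBl _].
assert (B : (Cmod (betaB a n) <= M * L ^ n)%R).
{ replace (betaB a n) with (- ((Fint a n w - betaB a n) + (0 - Fint a n w))) by ring.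
  rewrite Cmod_opp. eapply Rle_trans; [apply Cmod_triangle|]. unfold M. lra. }
assert (Pcn : (0 < c ^ n)%R) by (apply pow_lt; lra).
assert (D : (INR n * INR n * L ^ n <= Q * c ^ n)%R).
{ replace L with (L / c * c)%R by (field; lra). rewrite Rpow_mult_distr, <- Rmult_assoc.
  apply Rmult_le_compat_r; [lra | apply HQ]. }
assert (PM : (0 <= M)%R) by (unfold M; lra).
assert (G1 : (INR n * (k * c ^ n) <= INR n * (INR n * (M * L ^ n)))%R).
{ apply Rmult_le_compat_l; [lra|]. eapply Rle_trans; [exact HBl|]. apply Rmult_le_compat_l; lra. }
pose proof (Rmult_le_compat_l M _ _ PM D) as G2.
assert (G3 : (INR n * k * c ^ n <= M * Q * c ^ n)%R) by lra.
apply Rmult_le_reg_r in G3; [|exact Pcn].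
assert (G4 : ((M * Q + 1) / k * k <= INR n * k)%R) by (apply Rmult_le_compat_r; lra).
unfold Rdiv in G4. rewrite Rmult_assoc, Rinv_l in G4; lra.
Qed.

Lemma nonzero_off_level_curve (a w : C) : (0 < Re a)%R -> (Rabs (Im w) <= PI)%R ->
  Cmod (qf a w) <> Cmod (qf a (saddle a)) ->
  exists N : nat, nearC w (fun u => forall n, (N <= n)%nat -> Fint a n u <> 0).
Proof.
intros Ha Hw Hne. pose proof (qf_saddle_pos a Ha) as P0. pose proof PI_RGT_0.
set (c := Cmod (qf a (saddle a))) in *.
pose proof (near_close0_or_close1 a w Ha Hw) as Dich. fold c in Dich.
pose proof (Cmod_ge_0 (qf a w)) as Pq.
destruct (Rlt_le_dec (Cmod (qf a w)) c) as [Hlt|Hge].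
- set (L := ((Cmod (qf a w) + c) / 2)%R).
  destruct (classic (close1 a L w)) as [H1|H1].
  { apply (nonzero_of_close1 a L w Ha); [fold c; unfold L; lra | unfold L; lra | exact H1]. }
  assert (N1 : Cexp w <> 1).
  { intros E. assert (Z : w = 0) by (apply Cexp_eq_1; [exact E | lra]). subst w.
    apply H1. apply nearC_point. apply close1_near_0; [exact Ha | unfold L; lra]. }
  apply Fint_nonzero_near; [exact Ha | exact N1 | now apply gradq_neq_0|].
  destruct (near_Cmod_lt (qf a) w L ltac:(unfold L; lra) (Ccont_qf a w)) as [d [Pd Hd]].
  generalize (nearC_and _ _ _ Dich (ex_intro _ d (conj Pd (fun u h => h)))).
  apply nearC_impl. intros w' [Hdi Dw'] Hq'. pose proof (Cmod_ge_0 (qf a w')).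
  (* Strictly between |q(w')| and |q(w)|, hence below c. The second estimate at w' with this L'
     would pass to w at level L, which has been excluded; so the first one holds. *)
  set (L' := ((Cmod (qf a w') + Cmod (qf a w)) / 2)%R).
  exists L'. split; [unfold L'; lra|].
  destruct (Hdi L') as [HC|HC]; [unfold L'; lra | unfold L'; lra | unfold L'; lra | exact HC |].
  exfalso. apply H1.
  apply (close_at_segment a (betaB a) L w' w Ha).
  + intros t Ht. left. apply Hd. apply segment_in_ball; [exact Ht | exact Dw' |].
    replace (w - w) with (RtoC 0) by ring. now rewrite Cmod_0.
  + destruct HC as [K [PK HK]]. exists K. split; [exact PK|]. intros n Hn.
    eapply Rle_trans; [apply HK, Hn|]. apply Rmult_le_compat_l; [exact PK|].
    apply pow_incr. unfold L', L in *; lra.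
- assert (N1 : Cexp w <> 1).
  { intros E. assert (Z : Cmod (qf a w) = 0%R); [|lra].
    unfold qf. rewrite E. replace (1 - 1) with (RtoC 0) by ring. now rewrite Cmult_0_r, Cmod_0. }
  apply Fint_nonzero_near; [exact Ha | exact N1 | now apply gradq_neq_0|].
  generalize Dich. apply nearC_impl. intros w' Hdi Hq'.
  (* The maximum with c keeps L' above the saddle level, where the second estimate implies the
     first. *)
  set (L' := ((Rmax (Cmod (qf a w')) c + Cmod (qf a w)) / 2)%R).
  pose proof (Rmax_l (Cmod (qf a w')) c). pose proof (Rmax_r (Cmod (qf a w')) c).
  assert (Rmax (Cmod (qf a w')) c < Cmod (qf a w))%R by (apply Rmax_lub_lt; lra).
  exists L'. split; [unfold L'; lra|].
  destruct (Hdi L') as [HC|HC]; [unfold L'; lra | unfold L'; lra | unfold L'; lra | exact HC |].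
  apply close1_close0; [exact Ha | fold c; unfold L'; lra | exact HC].
Qed.

(** * Return to the polynomials and the variable z *)

Lemma p_jacQ (a : C) (n : nat) (z : C) : (0 < Re a)%R -> p a n z = jacQ n (bpar a n) z.
Proof.
intros Ha. unfold p. replace (a * INR n + 2) with (bpar a n + 1) by (unfold bpar; ring).
apply hyp2F1_neg_jacQ. pose proof (Re_bpar a n Ha). lra.
Qed.

Lemma p_nonzero_near_0 (a : C) : (0 < Re a)%R -> nearC 0 (fun z => forall n, p a n z <> 0).
Proof.
intros Ha. assert (Pa : (0 < Cmod a)%R) by (now apply Cmod_gt_0, Re_pos_neq_0).
(* Then |1 - z| >= 1/2 and 4 n |z| <= n |a| / 2, which together give the hypothesis of
   [jacQ_near_pow]. *)
set (d := Rmin (1 / 2) (Cmod a / 8)). exists d.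
assert (Pd : (0 < d)%R) by (apply Rmin_pos; lra).
pose proof (Rmin_l (1 / 2) (Cmod a / 8)) as D1. pose proof (Rmin_r (1 / 2) (Cmod a / 8)) as D2.
fold d in D1, D2.
split; [exact Pd|]. intros z Hz n E.
replace (z - 0) with z in Hz by ring.
pose proof (Re_bpar a n Ha) as Rb. pose proof (pos_INR n) as Pn.
assert (Z1 : (1 / 2 <= Cmod (1 - z))%R).
{ assert (1 <= Cmod (1 - z) + Cmod z)%R; [|lra].
  rewrite <- Cmod_1 at 1. replace (RtoC 1) with ((1 - z) + z) at 1 by ring. apply Cmod_triangle. }
assert (B : (INR n * Cmod a <= Cmod (bpar a n + 1))%R).
{ rewrite <- (Rabs_pos_eq (INR n)), <- Cmod_R, <- Cmod_mult by lra.
  unfold bpar, Cmod; apply sqrt_le_1_alt. simpl. unfold Re in Ha.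
  assert (0 <= fst a * INR n)%R by (apply Rmult_le_pos; lra). nra. }
assert (Q : (Cmod (jacQ n (bpar a n) z - (1 - z) ^ n) <= / 2 * Cmod (1 - z) ^ n)%R).
{ apply jacQ_near_pow; [lra|].
  apply Rle_trans with (INR n * Cmod a * (1 / 2))%R.
  - assert (INR n * Cmod z <= INR n * (Cmod a / 8))%R by (apply Rmult_le_compat_l; lra). lra.
  - apply Rmult_le_compat; [apply Rmult_le_pos; lra | lra | exact B | exact Z1]. }
rewrite <- p_jacQ, E in Q by exact Ha.
replace (0 - (1 - z) ^ n) with (- (1 - z) ^ n) in Q by ring.
rewrite Cmod_opp, Cmod_pow in Q.
assert (0 < Cmod (1 - z) ^ n)%R by (apply pow_lt; lra). lra.
Qed.

Lemma Cmod_Cpower_qf (a z : C) : z <> 0 -> Cmod (Cpower z a * (1 - z)) = Cmod (qf a (Clog z)).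
Proof.
intros Hz. unfold Cpower. destruct (Ceq_dec z 0) as [|_]; [contradiction|].
unfold qf. now rewrite Cexp_Clog.
Qed.

Lemma Im_Clog (z : C) : z <> 0 -> (- PI < Im (Clog z) <= PI)%R.
Proof. intros Hz. apply (Carg_spec z Hz). Qed.

Lemma zeros_limit (a : C) (nj : nat -> nat) (zj : nat -> C) (z : C) :
  (0 < Re a)%R -> filterlim nj eventually eventually ->
  (forall j, p a (nj j) (zj j) = 0) -> filterlim zj eventually (locally z) ->
  Cmod (Cpower z a * (1 - z)) = Cmod (Cpower (a / (a + 1)) a * / (a + 1)).
Proof.
intros Ha Hnj Hz Hzj.
pose proof (succ_neq_0 a Ha) as N. pose proof PI_RGT_0.
assert (Nu : a / (a + 1) <> 0).
{ rewrite <- Cexp_saddle by exact Ha. apply Cexp_neq_0. }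
replace (/ (a + 1)) with (1 - a / (a + 1)) by (field; exact N).
rewrite (Cmod_Cpower_qf a _ Nu).
replace (Clog (a / (a + 1))) with (saddle a).
(* Both are logarithms of the same number with imaginary parts less than 2 PI apart, so the
   principal branch in the statement is the saddle of the strip. *)
2: { apply Cexp_inj; [rewrite Cexp_saddle, Cexp_Clog by assumption; reflexivity|].
     pose proof (Im_saddle a) as B. apply Rabs_def2 in B.
     pose proof (Im_Clog _ Nu). apply Rabs_def1; lra. }
assert (Lim : forall P : C -> Prop, nearC z P -> exists J : nat, forall j, (J <= j)%nat -> P (zj j)).
{ intros P HP. exact (Hzj P (nearC_locally z P HP)). }
destruct (classic (z = 0)) as [->|Nz].
{ exfalso. destruct (Lim _ (p_nonzero_near_0 a Ha)) as [J HJ]. exact (HJ J (le_n J) _ (Hz J)). }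
rewrite (Cmod_Cpower_qf a z Nz).
apply NNPP. intros Hne.
pose proof (Im_Clog z Nz) as Iz.
destruct (nonzero_off_level_curve a (Clog z) Ha) as [M [d [Pd Hd]]];
  [apply Rabs_le_between; lra | exact Hne|].
pose proof (Cexp_locally_onto (Clog z) d Pd) as Onto. rewrite Cexp_Clog in Onto by exact Nz.
destruct (Lim _ Onto) as [J HJ].
destruct (Hnj (fun n => (M <= n)%nat)) as [J' HJ']; [now exists M|].
set (j := Nat.max J J').
destruct (HJ j) as [u [Eu Du]]; [unfold j; lia|].
assert (Hn : (M <= nj j)%nat) by (apply HJ'; unfold j; lia).
apply (Hd u Du (nj j) Hn). unfold Fint. rewrite Eu, <- p_jacQ, Hz by exact Ha.
unfold Cdiv. ring.
Qed.

Local Close Scope C_scope.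

Theorem mainTheorem1 :
  forall (eta zeta : R) (alpha : C),
    (0 < eta)%R -> zeta <> 0%R ->
    alpha = (eta + Ci * zeta)%C ->
    forall (nj : nat -> nat) (zj : nat -> C) (z : C),
      (forall j, (0 < nj j)%nat) ->
      filterlim nj eventually eventually ->
      (forall j, p alpha (nj j) (zj j) = RtoC 0) ->
      filterlim zj eventually (locally z) ->
      Cmod (Cpower z alpha * (1 - z))%C
      = Cmod (Cpower (alpha / (alpha + 1)) alpha * / (alpha + 1))%C.
Proof.
intros eta zeta alpha Heta _ Ealpha nj zj z _ Hnj Hz Hzj.
apply (zeros_limit alpha nj zj z); try assumption.
rewrite Ealpha; unfold Re; simpl; lra.
Qed.
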